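(* Let $d,N\ge 1$ and $1\le n\le d+1$ be integers, let $\kappa_n>0$, and let $\mathcal S\subset\{1,\dots,N\}^{n+1}$ be a set of ordered $(n+1)$-tuples that is invariant under all permutations of the entries of a tuple and such that for every $i\in\{1,\dots,N\}$ the set $\mathcal S_i=\{(j_1,\dots,j_n)\in\{1,\dots,N\}^n:(j_1,\dots,j_n,i)\in\mathcal S\}$ is nonempty. Let $x_1,\dots,x_N:[0,\infty)\to\mathbb{R}^d$ be a solution of the reduced gradient flow $$\dot x_i=-\nabla_{x_i}\mathcal V_n^R(\mathcal X)=-\frac{\kappa_n}{2|\mathcal S|}\sum_{(j_1,\dots,j_n)\in\mathcal S_i}\nabla_{x_i}\mathrm{Vol}_n(x_{j_1},\dots,x_{j_n},x_i)^2,\quad t>0,\qquad x_i(0)=x_i^0\in\mathbb{R}^d,\quad i=1,\dots,N.$$ Then for every $i\in\{1,\dots,N\}$ there exists $x_i^\infty\in\mathbb{R}^d$ such that $\lim_{t\to\infty}x_i(t)=x_i^\infty$. Furthermore, for every $(j_1,\dots,j_{n+1})\in\mathcal S$ there exists an $(n-1)$-dimensional affine subspace $P^\infty\subset\mathbb{R}^d$ (possibly depending on the tuple) such that $\{x_{j_1}^\infty,\dots,x_{j_{n+1}}^\infty\}\subset P^\infty$.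
   Context: For $y_1,\dots,y_{n+1}\in\mathbb{R}^d$, $\mathrm{Vol}_n(y_1,\dots,y_{n+1})\ge 0$ denotes the $n$-dimensional volume of the (possibly degenerate) $n$-simplex with vertices $y_1,\dots,y_{n+1}$. Explicitly, with $B_{ij}=\|y_i-y_j\|^2$, $$\mathrm{Vol}_n(y_1,\dots,y_{n+1})^2=\frac{(-1)^{n+1}}{2^n(n!)^2}\det\begin{bmatrix}0&\mathbf 1^\top\\ \mathbf 1&B\end{bmatrix},\qquad \mathbf 1=(1,\dots,1)^\top\in\mathbb{R}^{n+1}.$$ In particular it is zero when two vertices coincide. For $\mathcal X=(x_1,\dots,x_N)\in(\mathbb{R}^d)^N$, the reduced potential associated with $\mathcal S$ is $$\mathcal V_n^R(\mathcal X)=\frac{\kappa_n}{2(n+1)|\mathcal S|}\sum_{(j_1,\dots,j_{n+1})\in\mathcal S}\mathrm{Vol}_n(x_{j_1},\dots,x_{j_{n+1}})^2 ,$$ where $|\mathcal S|$ is the number of elements of $\mathcal S$ and $\kappa_n$ is the attractive coupling strength. *)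

(* Defs.v *)
From HB Require Import structures.
From mathcomp Require Import all_boot all_order all_algebra all_fingroup.
From mathcomp Require Import all_classical all_reals all_analysis.
Set Implicit Arguments.
Unset Strict Implicit.
Unset Printing Implicit Defensive.
Import Order.TTheory GRing.Theory Num.Theory.
Import numFieldNormedType.Exports.
Local Open Scope ring_scope.
Local Open Scope classical_set_scope.

(* The norm that the library puts on 'rV_d is the sup norm (with the usual
   topology), so the squared Euclidean distance is written out. *)
Definition sqdist (R : realType) (d : nat) (u v : 'rV[R]_d) : R :=
  \sum_(k < d) (u 0 k - v 0 k) ^+ 2.

Definition cayley_menger (R : realType) (d n : nat)
    (y : 'I_n.+1 -> 'rV[R]_d) : 'M[R]_(1 + n.+1) :=
  block_mx 0 (const_mx 1)
           (const_mx 1) (\matrix_(i, j) sqdist (y i) (y j)).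

Definition Vol (R : realType) (d n : nat) (y : 'I_n.+1 -> 'rV[R]_d) : R :=
  Num.sqrt ((-1) ^+ n.+1 / (2 ^+ n * n`!%:R ^+ 2) * \det (cayley_menger y)).

Definition grad (R : realType) (d : nat) (f : 'rV[R]_d -> R) (x : 'rV[R]_d) :
    'rV[R]_d :=
  \row_(k < d) 'D_(delta_mx 0 k) f x.

Definition grad_at (R : realType) (d N : nat)
    (F : ('I_N -> 'rV[R]_d) -> R) (i : 'I_N) (X : 'I_N -> 'rV[R]_d) :
    'rV[R]_d :=
  grad (fun y => F [eta X with i |-> y]) (X i).

Definition reduced_potential (R : realType) (d n N : nat) (kappa : R)
    (S : {set n.+1.-tuple 'I_N}) (X : 'I_N -> 'rV[R]_d) : R :=
  kappa / (2 * n.+1%:R * #|S|%:R) *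
    \sum_(j in S) Vol (fun k : 'I_n.+1 => X (tnth j k)) ^+ 2.

Definition perm_invariant (n N : nat) (S : {set n.+1.-tuple 'I_N}) : Prop :=
  forall (s : 'S_n.+1) (j : n.+1.-tuple 'I_N),
    j \in S -> [tuple tnth j (s k) | k < n.+1] \in S.

Definition slice (n N : nat) (S : {set n.+1.-tuple 'I_N}) (i : 'I_N) :
    {set n.-tuple 'I_N} :=
  [set j : n.-tuple 'I_N | [tuple of rcons j i] \in S]%SET.

(* Values of x at negative times are irrelevant. *)
Definition reduced_gradient_flow (R : realType) (d n N : nat) (kappa : R)
    (S : {set n.+1.-tuple 'I_N}) (x0 : 'I_N -> 'rV[R]_d)
    (x : 'I_N -> R -> 'rV[R]_d) : Prop :=
  forall i : 'I_N,
    [/\ {within `[0, +oo[, continuous (x i)},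
        x i 0 = x0 i &
        forall t : R, 0 < t ->
          is_derive t (1 : R) (x i)
            (- grad_at (reduced_potential kappa S) i (fun l => x l t))].

Definition affine_subspace (R : realType) (d m : nat) (P : set 'rV[R]_d) :
    Prop :=
  exists (p : 'rV[R]_d) (W : {vspace 'rV[R]_d}),
    \dim W = m /\ P = [set p + w | w in [set w | w \in W]].

(* Main.v *)
Require Import Defs.
From HB Require Import structures.
From mathcomp Require Import all_boot all_order all_algebra all_fingroup.
From mathcomp Require Import all_classical all_reals all_analysis.
From mathcomp Require Import ring lra.
From mathcomp Require Import polyrcf ordered_qelim qe_rcf.
Set Implicit Arguments.
Unset Strict Implicit.
Unset Printing Implicit Defensive.
Import Order.TTheory GRing.Theory Num.Theory.
Import numFieldNormedType.Exports.
Local Open Scope ring_scope.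
Local Open Scope classical_set_scope.

(* The squared volume is a Gram determinant divided by (n!)^2, so the potential V
   is a nonnegative polynomial, homogeneous of degree 2n.  By Euler's identity
   X . grad V = 2n V, the flow decreases |X| and V(X(t)) tends to 0; hence any
   limit has all volumes 0, that is, degenerate simplices.

   Convergence of the bounded trajectory follows from a Lojasiewicz inequality
   f <= C f^b |grad f| (b > 0) on a ball near the level 0, for f polynomial: it
   makes x_k + C' f^b monotone along the flow.  To prove the inequality, let gamma(t)
   be a minimizer of |grad f| on {f = 1/t}, selected lexicographically.  By
   quantifier elimination over the reals, u(t) = t (gamma_k(t+1) - gamma_k(t))
   satisfies P(t, u(t)) = 0 for some nonzero polynomial P; the leading coefficient
   of P in t forces |u| >= eps or |u|^j <= C/t, and definability makes one of these
   alternatives (with a constant sign of u) hold for all large t.  The first one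
   contradicts the boundedness of gamma, as the series 1/t diverges.  The second
   one and Taylor's formula for f(gamma(t+1)) - f(gamma(t)) = -1/(t(t+1)) bound
   |grad f| from below along gamma. *)

(** * Polynomial functions and definable sets *)

(** The index type is arbitrary so that one polynomial can be read both on vectors ['I_m -> R] and
    on the environments [nat -> R] of formulas. *)
Inductive polyfun (R : realType) (I : Type) : ((I -> R) -> R) -> Prop :=
| polyfun_cst c : polyfun (fun _ => c)
| polyfun_var i : polyfun (fun e => e i)
| polyfun_add f g : polyfun f -> polyfun g -> polyfun (fun e => f e + g e)
| polyfun_mul f g : polyfun f -> polyfun g -> polyfun (fun e => f e * g e).

Section Polyfun.
Context {R : realType}.

Lemma eq_polyfun (I : Type) (f g : (I -> R) -> R) :
  f =1 g -> polyfun f -> polyfun g.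
Proof. by move=> /funext->. Qed.

Lemma polyfun_comp (I J : Type) (f : (I -> R) -> R) (h : I -> (J -> R) -> R) :
  polyfun f -> (forall i, polyfun (h i)) -> polyfun (fun e => f (h^~ e)).
Proof.
move=> + hh; elim=> [c|i|f1 f2 _ + _|f1 f2 _ + _].
- exact: polyfun_cst.
- exact: hh.
- exact: polyfun_add.
- exact: polyfun_mul.
Qed.

Lemma polyfun_opp (I : Type) (f : (I -> R) -> R) :
  polyfun f -> polyfun (fun e => - f e).
Proof.
move=> pf; apply: eq_polyfun (polyfun_mul (polyfun_cst _ (-1)) pf) => e.
by rewrite mulN1r.
Qed.

Lemma polyfun_sub (I : Type) (f g : (I -> R) -> R) :
  polyfun f -> polyfun g -> polyfun (fun e => f e - g e).
Proof. by move=> pf pg; apply: polyfun_add => //; exact: polyfun_opp. Qed.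

Lemma polyfun_exp (I : Type) (f : (I -> R) -> R) n :
  polyfun f -> polyfun (fun e => f e ^+ n).
Proof.
move=> pf; elim: n => [|n IH].
  exact: polyfun_cst.
by apply: eq_polyfun (polyfun_mul pf IH) => e; rewrite exprS.
Qed.

Lemma polyfun_sum (I T : Type) (s : seq T) (P : pred T)
    (F : T -> (I -> R) -> R) :
  (forall i, P i -> polyfun (F i)) ->
  polyfun (fun e => \sum_(i <- s | P i) F i e).
Proof.
move=> pF; elim: s => [|a s IH].
  by apply: eq_polyfun (polyfun_cst _ 0) => e; rewrite big_nil.
have [Pa|Pa] := boolP (P a).
  by apply: eq_polyfun (polyfun_add (pF a Pa) IH) => e; rewrite big_cons Pa.
by apply: eq_polyfun IH => e; rewrite big_cons (negbTE Pa).
Qed.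

Lemma polyfun_prod (I T : Type) (s : seq T) (F : T -> (I -> R) -> R) :
  (forall i, polyfun (F i)) -> polyfun (fun e => \prod_(i <- s) F i e).
Proof.
move=> pF; elim: s => [|a s IH].
  by apply: eq_polyfun (polyfun_cst _ 1) => e; rewrite big_nil.
by apply: eq_polyfun (polyfun_mul (pF a) IH) => e; rewrite big_cons.
Qed.

Lemma polyfun_det (I : Type) n (M : (I -> R) -> 'M[R]_n) :
  (forall i j, polyfun (fun e => M e i j)) -> polyfun (fun e => \det (M e)).
Proof.
move=> pM; rewrite /determinant; apply: polyfun_sum => s _.
by apply: polyfun_mul; [exact: polyfun_cst|exact: polyfun_prod].
Qed.

Lemma polyfun_continuous m (f : ('I_m -> R) -> R) :
  polyfun f -> continuous (fun x : 'rV[R]_m => f (x ord0)).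
Proof.
elim=> [c|i|f1 f2 _ + _|f1 f2 _ + _].
- exact: cst_continuous.
- exact: coord_continuous.
- by move=> c1 c2 x; exact: continuousD (c1 x) (c2 x).
- by move=> c1 c2 x; exact: continuousM (c1 x) (c2 x).
Qed.

End Polyfun.

Section Definable.
Context {R : realType}.
Implicit Types A B : (nat -> R) -> Prop.

(** Formulas are evaluated on finite sequences, read as total environments through the default value
    0; [rformula] excludes inverses, as quantifier elimination requires. *)
Definition definable A := exists2 phi : ord.formula R,
  ord.rformula phi & forall e : seq R, ord.holds e phi <-> A (nth 0 e).

Lemma polyfun_term (f : (nat -> R) -> R) : polyfun f ->
  exists2 t : GRing.term R,
    GRing.rterm t & forall e : seq R, GRing.eval e t = f (nth 0 e).
Proof.
elim=> [c|i|f1 f2 _ [t1 r1 E1] _ [t2 r2 E2]|f1 f2 _ [t1 r1 E1] _ [t2 r2 E2]].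
- by exists (GRing.Const c).
- by exists (GRing.Var _ i).
- by exists (GRing.Add t1 t2); rewrite /= ?r1// => e; rewrite E1 E2.
- by exists (GRing.Mul t1 t2); rewrite /= ?r1// => e; rewrite E1 E2.
Qed.

Lemma definable_lt f g : polyfun f -> polyfun g ->
  definable (fun e => f e < g e).
Proof.
move=> /polyfun_term[t rt Et] /polyfun_term[u ru Eu].
by exists (ord.Lt t u); rewrite /= ?rt// => e; rewrite Et Eu.
Qed.

Lemma definable_le f g : polyfun f -> polyfun g ->
  definable (fun e => f e <= g e).
Proof.
move=> /polyfun_term[t rt Et] /polyfun_term[u ru Eu].
by exists (ord.Le t u); rewrite /= ?rt// => e; rewrite Et Eu.
Qed.

Lemma definable_eq f g : polyfun f -> polyfun g ->
  definable (fun e => f e = g e).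
Proof.
move=> /polyfun_term[t rt Et] /polyfun_term[u ru Eu].
by exists (ord.Equal t u); rewrite /= ?rt// => e; rewrite Et Eu.
Qed.

Lemma definable_and A B : definable A -> definable B ->
  definable (fun e => A e /\ B e).
Proof.
move=> [p rp Ep] [q rq Eq]; exists (ord.And p q); rewrite /= ?rp// => e.
by rewrite Ep Eq.
Qed.

Lemma definable_or A B : definable A -> definable B ->
  definable (fun e => A e \/ B e).
Proof.
move=> [p rp Ep] [q rq Eq]; exists (ord.Or p q); rewrite /= ?rp// => e.
by rewrite Ep Eq.
Qed.

Lemma definable_imply A B : definable A -> definable B ->
  definable (fun e => A e -> B e).
Proof.
move=> [p rp Ep] [q rq Eq]; exists (ord.Implies p q); rewrite /= ?rp// => e.
by rewrite Ep Eq.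
Qed.

Lemma definable_not A : definable A -> definable (fun e => ~ A e).
Proof.
by move=> [p rp Ep]; exists (ord.Not p); rewrite /= ?rp// => e; rewrite Ep.
Qed.

Lemma definable_ex i A : definable A ->
  definable (fun e => exists y, A [eta e with i |-> y]).
Proof.
move=> [p rp Ep]; exists (ord.Exists i p); rewrite /= ?rp// => e.
have E y : nth 0 (set_nth 0 e i y) = [eta nth 0 e with i |-> y].
  by apply/funext => k; exact: nth_set_nth.
by split=> -[y Hy]; exists y; move: Hy; rewrite Ep E.
Qed.

(** Quantifying over a whole function [x] remains first-order because only its entries from [o] to
    [o + m - 1] are read; they are bound one at a time. *)
Lemma definable_exn o m A : definable A -> definable
  (fun e => exists x : nat -> R, A (fun i => if (o <= i < o + m)%N then x i else e i)).
Proof.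
elim: m A => [|m IH] A dA.
  have E (e x : nat -> R) : (fun i => if (o <= i < o + 0)%N then x i else e i) = e.
    by apply/funext => i; rewrite addn0 ltnNge andbN.
  rewrite (_ : (fun _ => _) = A)//; apply/funext => e; apply/propext.
  by split=> [[x]|Ae]; [rewrite E|exists e; rewrite E].
have := IH _ (definable_ex (o + m) dA).
congr definable; apply/funext => e; apply/propext; split=> [[x [y Axy]]|[x Ax]].
  exists [eta x with (o + m)%N |-> y]; move: Axy; congr A; apply/funext => i /=.
  by rewrite addnS ltnS (leq_eqVlt i); case: eqP => [->|]//; rewrite leq_addr.
exists x, (x (o + m)%N); move: Ax; congr A; apply/funext => i /=.
rewrite addnS ltnS (leq_eqVlt i); case: eqP => [->|]//.
by rewrite leq_addr.
Qed.

End Definable.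

(** * Semialgebraic functions of one variable at infinity *)

Section EventualSigns.
Context {R : realType}.

Lemma definable_qf (A : (nat -> R) -> Prop) : definable A ->
  exists phi : ord.formula R, [/\ ord.qf_form phi, ord.rformula phi &
    forall e : seq R, ord.qf_eval e phi <-> A (nth 0 e)].
Proof.
move=> [phi rphi Ephi].
exists (ord.quantifier_elim (@wproj R) phi).
have /andP[? ?] := ord.quantifier_elim_wf (@wf_QE_wproj R) rphi.
split=> // e; rewrite -Ephi.
exact: iff_sym (rwP (ord.quantifier_elim_rformP (@wf_QE_wproj R) (@valid_QE_wproj R) e rphi)).
Qed.

Lemma poly_sg_pinfty (p : {poly R}) :
  \forall t \near +oo, Num.sg p.[t] = sgp_pinfty p.
Proof.
have [->|p0] := eqVneq p 0.
  by apply: nearW => t; rewrite horner0 /sgp_pinfty lead_coef0.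
exists (cauchy_bound p); split; first exact: num_real.
move=> t /ltW ht; apply: (@sgp_pinftyP _ (cauchy_bound p)).
  exact: ge_cauchy_bound.
by rewrite in_itv/= ht.
Qed.

(** The outer indeterminate is variable 0, the parameter tending to infinity; the coefficients are
    polynomials in variable 1. This order makes the leading coefficient in the parameter available
    to [algebraic_decay]. *)
Lemma rterm_poly (t : GRing.term R) : GRing.rterm t ->
  exists P : {poly {poly R}}, forall a u : R,
    GRing.eval [:: a; u] t = P.[a%:P].[u].
Proof.
elim: t => //=.
- move=> [|[|n]] _; first by exists 'X => a u; rewrite hornerX hornerC.
    by exists 'X%:P => a u; rewrite hornerC hornerX.
  by exists 0 => a u; rewrite /= !horner0 nth_nil.
- by move=> c _; exists c%:P%:P => a u; rewrite !hornerC.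
- by move=> n _; exists (n%:R)%:P%:P => a u; rewrite !hornerC.
- move=> t1 IH1 t2 IH2 /andP[/IH1[P1 E1] /IH2[P2 E2]].
  by exists (P1 + P2) => a u; rewrite E1 E2 !hornerD.
- by move=> t1 IH1 /IH1[P1 E1]; exists (- P1) => a u; rewrite E1 !hornerN.
- by move=> t1 IH1 n /IH1[P1 E1]; exists (P1 *+ n) => a u; rewrite E1 !hornerMn.
- move=> t1 IH1 t2 IH2 /andP[/IH1[P1 E1] /IH2[P2 E2]].
  by exists (P1 * P2) => a u; rewrite E1 E2 !hornerM.
- by move=> t1 IH1 n /IH1[P1 E1]; exists (P1 ^+ n) => a u; rewrite E1 !horner_exp.
Qed.

Lemma rterm_poly1 (t : GRing.term R) : GRing.rterm t ->
  exists p : {poly R}, forall a : R, GRing.eval [:: a] t = p.[a].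
Proof.
move=> /rterm_poly[P EP]; exists (map_poly (horner_eval 0) P) => a.
have <- : GRing.eval [:: a; 0] t = GRing.eval [:: a] t.
  by apply: GRing.eq_eval => -[|[|i]] //=; rewrite nth_nil.
rewrite EP -[X in _ = _.[X]](hornerC a 0) -/(horner_eval 0 a%:P) horner_map//.
Qed.

(** Each atom is a sign condition on a polynomial in [t], whose sign is constant near infinity;
    connectives preserve being eventually constant. *)
Lemma qf_dichotomy (phi : ord.formula R) : ord.qf_form phi -> ord.rformula phi ->
  exists b : bool, \forall t \near +oo, ord.qf_eval [:: t] phi = b.
Proof.
have sub t1 t2 : GRing.rterm t1 && GRing.rterm t2 -> exists s : R,
  \forall a \near +oo,
    Num.sg (GRing.eval [:: a] t1 - GRing.eval [:: a] t2) = s.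
  move=> /andP[/rterm_poly1[p Ep] /rterm_poly1[q Eq]].
  exists (sgp_pinfty (p - q)); near=> a; rewrite Ep Eq -hornerN -hornerD.
  by near: a; exact: poly_sg_pinfty.
elim: phi => //=.
- by move=> b _ _; exists b; exact: nearW.
- move=> t1 t2 _ /sub[s Hs]; exists (s == 0); apply: filterS Hs => a <-.
  by rewrite sgr_eq0 subr_eq0.
- move=> t1 t2 _ /sub[s Hs]; exists (s < 0); apply: filterS Hs => a <-.
  by rewrite sgr_lt0 subr_lt0.
- move=> t1 t2 _ /sub[s Hs]; exists (s <= 0); apply: filterS Hs => a <-.
  by rewrite sgr_le0 subr_le0.
- move=> f IHf g IHg /andP[/IHf{}IHf /IHg{}IHg] /andP[/IHf[b Hb] /IHg[c Hc]].
  by exists (b && c); apply: filterS2 Hb Hc => a -> ->.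
- move=> f IHf g IHg /andP[/IHf{}IHf /IHg{}IHg] /andP[/IHf[b Hb] /IHg[c Hc]].
  by exists (b || c); apply: filterS2 Hb Hc => a -> ->.
- move=> f IHf g IHg /andP[/IHf{}IHf /IHg{}IHg] /andP[/IHf[b Hb] /IHg[c Hc]].
  by exists (b ==> c); apply: filterS2 Hb Hc => a -> ->.
- move=> f IHf /IHf{}IHf /IHf[b Hb].
  by exists (~~ b); apply: filterS Hb => a ->.
Unshelve. all: by end_near. Qed.

Lemma definable_dichotomy (A : (nat -> R) -> Prop) : definable A ->
  (\forall t \near +oo, A (nth 0 [:: t])) \/
  (\forall t \near +oo, ~ A (nth 0 [:: t])).
Proof.
move=> /definable_qf[phi [qphi rphi Ephi]].
have [[] Hb] := qf_dichotomy qphi rphi; [left|right];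
  by apply: filterS Hb => t Ht; rewrite -Ephi Ht.
Qed.

(** [Q] is the product, over the atoms, of the differences of their two sides. A difference that is
    identically zero never changes sign and contributes the factor 1; the others keep their sign
    near [u] by continuity. *)
Lemma qf_signs (phi : ord.formula R) : ord.qf_form phi -> ord.rformula phi ->
  exists2 Q : {poly {poly R}}, Q != 0 & forall a u : R, Q.[a%:P].[u] != 0 ->
    \forall v \near u, ord.qf_eval [:: a; v] phi = ord.qf_eval [:: a; u] phi.
Proof.
have sub t1 t2 : GRing.rterm t1 && GRing.rterm t2 ->
  exists2 Q : {poly {poly R}}, Q != 0 & forall a u : R, Q.[a%:P].[u] != 0 ->
    \forall v \near u, Num.sg (GRing.eval [:: a; v] t1 - GRing.eval [:: a; v] t2)
                    = Num.sg (GRing.eval [:: a; u] t1 - GRing.eval [:: a; u] t2).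
  move=> /andP[/rterm_poly[P EP] /rterm_poly[Q EQ]].
  have [PQ|PQ] := eqVneq (P - Q) 0.
    exists 1; first exact: oner_neq0.
    by move=> a u _; near=> v; rewrite !EP !EQ -!hornerN -!hornerD PQ !horner0.
  exists (P - Q) => // a u nz.
  have /= cont : {for u, continuous (fun v => (P - Q).[a%:P].[v])}.
    exact: continuous_horner.
  have [pos|] := ltrP 0 (P - Q).[a%:P].[u].
    near=> v; rewrite !EP !EQ -!hornerN -!hornerD !gtr0_sg//.
    by near: v; exact: cvgr_gt cont _ pos.
  rewrite le_eqVlt (negbTE nz)/= => neg.
  near=> v; rewrite !EP !EQ -!hornerN -!hornerD !ltr0_sg//.
  by near: v; exact: cvgr_lt cont _ neg.
have two (f g : ord.formula R) (op : bool -> bool -> bool) :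
  (exists2 Q : {poly {poly R}}, Q != 0 & forall a u : R, Q.[a%:P].[u] != 0 ->
    \forall v \near u, ord.qf_eval [:: a; v] f = ord.qf_eval [:: a; u] f) ->
  (exists2 Q : {poly {poly R}}, Q != 0 & forall a u : R, Q.[a%:P].[u] != 0 ->
    \forall v \near u, ord.qf_eval [:: a; v] g = ord.qf_eval [:: a; u] g) ->
  (exists2 Q : {poly {poly R}}, Q != 0 & forall a u : R, Q.[a%:P].[u] != 0 ->
    \forall v \near u, op (ord.qf_eval [:: a; v] f) (ord.qf_eval [:: a; v] g) =
                    op (ord.qf_eval [:: a; u] f) (ord.qf_eval [:: a; u] g)).
  move=> [P P0 HP] [Q Q0 HQ]; exists (P * Q); first by rewrite mulf_neq0.
  move=> a u; rewrite !hornerM mulf_eq0 negb_or => /andP[/HP{}HP /HQ{}HQ].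
  by apply: filterS2 HP HQ => v -> ->.
elim: phi => //=.
- by move=> b _ _; exists 1; [exact: oner_neq0|move=> a u _; near=> v].
- move=> t1 t2 _ /sub[Q Q0 H]; exists Q => // a u /H; apply: filterS => v.
  by move=> E; rewrite -subr_eq0 -sgr_eq0 E sgr_eq0 subr_eq0.
- move=> t1 t2 _ /sub[Q Q0 H]; exists Q => // a u /H; apply: filterS => v.
  by move=> E; rewrite -subr_lt0 -sgr_lt0 E sgr_lt0 subr_lt0.
- move=> t1 t2 _ /sub[Q Q0 H]; exists Q => // a u /H; apply: filterS => v.
  by move=> E; rewrite -subr_le0 -sgr_le0 E sgr_le0 subr_le0.
- move=> f IHf g IHg /andP[/IHf{}IHf /IHg{}IHg] /andP[/IHf{}IHf /IHg{}IHg].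
  exact: (two f g andb).
- move=> f IHf g IHg /andP[/IHf{}IHf /IHg{}IHg] /andP[/IHf{}IHf /IHg{}IHg].
  exact: (two f g orb).
- move=> f IHf g IHg /andP[/IHf{}IHf /IHg{}IHg] /andP[/IHf{}IHf /IHg{}IHg].
  exact: (two f g implb).
- move=> f IHf /IHf{}IHf /IHf[Q Q0 H]; exists Q => // a u /H.
  by apply: filterS => v ->.
Unshelve. all: by end_near. Qed.

(* Where [Q] does not vanish, the truth of the formula is locally constant in
   [u], so its solution [u = h] cannot be unique. *)
Lemma definable_algebraic (A : (nat -> R) -> Prop) : definable A ->
  exists2 Q : {poly {poly R}}, Q != 0 & forall a h : R,
    (forall u, A (nth 0 [:: a; u]) <-> u = h) -> Q.[a%:P].[h] = 0.
Proof.
move=> /definable_qf[phi [qphi rphi Ephi]].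
have [Q Q0 HQ] := qf_signs qphi rphi; exists Q => // a h Ah.
apply: contrapT => /eqP /HQ.
have -> : ord.qf_eval [:: a; h] phi = true by apply/Ephi/Ah.
move=> [e /= e0 He]; have := He (h + e / 2).
rewrite /= opprD addrA subrr sub0r normrN gtr0_norm ?divr_gt0//.
rewrite ltr_pdivrMr// ltr_pMr// ltr1n => /(_ isT) /Ephi /Ah.
by move/eqP; rewrite -subr_eq0 addrC addKr mulf_eq0 (gt_eqF e0) invr_eq0 pnatr_eq0.
Qed.

(** Let b(u) be the leading coefficient of Q in a. On a root with a >= 1 and |u| <= 1, the top term
    equals minus the lower ones, so |b(u)| <= B/a. Writing b = u^j q with q(0) != 0 bounds |b(u)|
    below by |q(0)| |u|^j / 2 near 0. *)
Lemma algebraic_decay (Q : {poly {poly R}}) : Q != 0 ->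
  exists eps C (j : nat), [/\ 0 < eps, 0 < C, (0 < j)%N &
    forall a u : R, 1 <= a -> Q.[a%:P].[u] = 0 ->
      `|u| < eps -> `|u| ^+ j <= C / a].
Proof.
move=> Q0; set b := lead_coef Q.
have b0 : b != 0 by rewrite lead_coef_eq0.
have [j [q + Eb]] := multiplicity_XsubC b 0.
rewrite b0/= => q0.
have {}q0 : q.[0] != 0 by [].
have [B B0 HB] : exists2 B, 0 < B & forall a u : R, 1 <= a -> `|u| <= 1 ->
    Q.[a%:P].[u] = 0 -> `|b.[u]| <= B / a.
  pose S (p : {poly R}) := \sum_(i < size p) `|p`_i|.
  have HS (p : {poly R}) (u : R) : `|u| <= 1 -> `|p.[u]| <= S p.
    move=> u1; rewrite horner_coef (le_trans (ler_norm_sum _ _ _))// ler_sum// => i _.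
    by rewrite normrM normrX ler_piMr// exprn_ile1.
  exists (1 + \sum_(i < (size Q).-1) S Q`_i).
    by rewrite ltr_wpDr// sumr_ge0// => i _; rewrite sumr_ge0.
  move=> a u a1 u1 /eqP; rewrite [Q.[_]]horner_coef.
  have a0 : 0 < a by exact: lt_le_trans a1.
  have szQ : size Q = (size Q).-1.+1 by rewrite prednK// size_poly_gt0.
  rewrite szQ big_ord_recr/= -/(lead_coef Q) -/b hornerD addrC addr_eq0 => /eqP.
  rewrite hornerM -polyC_exp hornerC => /(congr1 (fun x => `|x|)).
  rewrite normrN normrM normrX (gtr0_norm a0) => E.
  rewrite ler_pdivlMr//.
  case D : (size Q).-1 E => [|D'] E.
    by move: E; rewrite big_ord0 horner0 normr0 expr0 mulr1 => ->; rewrite mul0r big_ord0; lra.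
  rewrite -(ler_pM2r (exprn_gt0 D' a0)) -mulrA -exprS {}E horner_sum.
  rewrite (le_trans (ler_norm_sum _ _ _))// mulrDl mul1r.
  rewrite ler_wpDl ?exprn_ge0 ?(ltW a0)// mulr_suml; apply: ler_sum => i _.
  rewrite hornerM -polyC_exp hornerC normrM normrX (gtr0_norm a0).
  by rewrite ler_pM ?exprn_ge0 ?(ltW a0)// ?HS// ler_weXn2l// -ltnS.
have [e /= e0 He] : \forall u \near (0 : R), `|q.[0]| / 2 < `|q.[u]|.
  have cont : {for (0 : R), continuous (fun u => `|q.[u]|)}.
    apply: continuous_comp; [exact: continuous_horner|exact: norm_continuous].
  apply: cvgr_gt cont _ _.
  by rewrite ltr_pdivrMr// ltr_pMr ?normr_gt0// ltr1n.
have q0' : 0 < `|q.[0]| by rewrite normr_gt0.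
(* The exponent is raised by one to be positive even when b(0) != 0; this costs nothing since |u| <
   1. *)
exists (Num.min e 1), (2 * B / `|q.[0]|), j.+1; split=> //.
- by rewrite lt_min e0 ltr01.
- by rewrite divr_gt0// mulr_gt0.
move=> a u a1 Qau; rewrite lt_min => /andP[ue u1].
have := HB a u a1 (ltW u1) Qau.
rewrite Eb hornerM horner_exp subr0 hornerX normrM normrX => Hb.
have {}He : `|q.[0]| / 2 < `|q.[u]| by apply: He; rewrite /= sub0r normrN.
have uj : `|u| ^+ j.+1 <= `|u| ^+ j by rewrite ler_wiXn2l// ltW.
apply: le_trans uj _.
have : `|q.[0]| / 2 * `|u| ^+ j <= B / a.
  by apply: le_trans Hb; rewrite ler_wpM2r ?exprn_ge0// ltW.
rewrite -ler_pdivlMl ?divr_gt0//; congr (_ <= _).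
by field; rewrite !gt_eqF// (lt_le_trans _ a1).
Unshelve. all: by end_near. Qed.

(* Otherwise [g] would grow at least like [eps * ln]. *)
Lemma bounded_increment (g : R -> R) (B eps : R) : 0 < eps ->
  (forall t, `|g t| <= B) ->
  ~ (\forall t \near +oo, eps <= t * (g (t + 1) - g t)).
Proof.
move=> e0 gB [M [_ HM]].
pose T := Num.max M 0 + 1.
have T0 : 0 < T by rewrite ltr_wpDl// le_max lexx orbT.
have HT n : g T + eps * (ln (T + n%:R) - ln T) <= g (T + n%:R).
  elim: n => [|n IH]; first by rewrite addr0 subrr mulr0 addr0.
  set s := T + n%:R in IH *.
  have s0 : 0 < s by rewrite ltr_wpDr.
  have -> : T + n.+1%:R = s + 1 by rewrite -natr1 addrA.
  have := HM s; rewrite (_ : M < s); last first.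
    rewrite (@lt_le_trans _ _ T)// ?lerDl//.
    by rewrite (@le_lt_trans _ _ (Num.max M 0)) ?le_max ?lexx// ltrDl.
  move=> /(_ isT); rewrite mulrC -ler_pdivrMr// => Hs.
  have : ln (s + 1) - ln s <= s^-1.
    have s10 : 0 < s + 1 by rewrite addr_gt0.
    rewrite -ln_div ?posrE//.
    rewrite mulrDl divff ?gt_eqF// mul1r.
    by rewrite le_ln1Dx// (lt_trans _ (_ : 0 < _)) ?ltrN10 ?invr_gt0.
  move=> /(ler_wpM2l (ltW e0)); rewrite mulrBr; move: IH.
  rewrite !mulrBr; lra.
have [n Hn] : exists n : nat, expR ((2 * B + 1) / eps + ln T) < n%:R.
  exists (Num.bound (expR ((2 * B + 1) / eps + ln T))).
  by rewrite archi_boundP// expR_ge0.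
have := HT n; have := gB T; have := gB (T + n%:R).
rewrite !ler_norml => /andP[_ h1] /andP[h2 _] h3.
have : (2 * B + 1) / eps + ln T < ln (T + n%:R).
  rewrite -ltr_expR lnK; last by rewrite posrE ltr_wpDr.
  by rewrite (lt_trans Hn)// ltrDr.
rewrite -ltrBrDr ltr_pdivrMr// mulrC; lra.
Qed.

End EventualSigns.

(** * Gradients and lexicographic minima *)

Section Gradient.
Context {R : realType} {m : nat}.
Implicit Types (f : ('I_m -> R) -> R) (x y : 'I_m -> R).

(** Specifies [g] as the gradient of [f] through its action along curves, the form in which
    trajectories use it. *)
Definition chain_rule f (g : 'I_m -> ('I_m -> R) -> R) :=
  forall (z : 'I_m -> R -> R) (dz : 'I_m -> R) (t : R),
    (forall k, is_derive t (1 : R) (z k) (dz k)) ->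
    is_derive t (1 : R) (fun s => f (z^~ s)) (\sum_k g k (z^~ t) * dz k).

(** The first three bounds carry the induction through products; the fourth, the quadratic
    remainder, is what the Lojasiewicz inequality uses. *)
Definition taylor_bound f (g : 'I_m -> ('I_m -> R) -> R) :=
  forall rho : R, exists2 C : R, 0 <= C & forall x y,
    (forall k, `|x k| <= rho) -> (forall k, `|y k| <= rho) ->
    let D := \sum_k `|y k - x k| in
    [/\ `|f x| <= C, `|f y - f x| <= C * D,
        `|\sum_k g k x * (y k - x k)| <= C * D &
        `|f y - f x - \sum_k g k x * (y k - x k)| <= C * D ^+ 2].

Lemma polyfun_gradient f : polyfun f -> exists g : 'I_m -> ('I_m -> R) -> R,
  [/\ forall k, polyfun (g k), chain_rule f g & taylor_bound f g].
Proof.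
elim=> [c|i|f1 f2 p1 [g1 [pg1 c1 t1]] p2 [g2 [pg2 c2 t2]]
       |f1 f2 p1 [g1 [pg1 c1 t1]] p2 [g2 [pg2 c2 t2]]].
- exists (fun _ _ => 0); split=> [k|z dz t hz|rho].
  + exact: polyfun_cst.
  + rewrite big1 => [|k _]; last by rewrite mul0r.
    exact: is_derive_cst.
  + exists `|c| => // x y hx hy /=.
    have -> : \sum_(k < m) 0 * (y k - x k) = 0.
      by rewrite big1 => // k _; rewrite mul0r.
    by rewrite subrr subr0 normr0 !mulr_ge0 ?exprn_ge0 ?sumr_ge0.
- exists (fun k _ => (k == i)%:R); split=> [k|z dz t hz|rho].
  + exact: polyfun_cst.
  + rewrite (bigD1 i)//= eqxx mul1r big1 ?addr0; first exact: hz.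
    by move=> k /negbTE->; rewrite mul0r.
  + exists (1 + `|rho|) => [|x y hx hy /=]; first by rewrite addr_ge0.
    have -> : \sum_k (k == i)%:R * (y k - x k) = y i - x i.
      rewrite (bigD1 i)//= eqxx mul1r big1 ?addr0// => k /negbTE->.
      by rewrite mul0r.
    have D0 : `|y i - x i| <= \sum_k `|y k - x k|.
      by rewrite (bigD1 i)//= ler_wpDr// sumr_ge0.
    have D1 : `|y i - x i| <= (1 + `|rho|) * \sum_k `|y k - x k|.
      by rewrite (le_trans D0)// ler_peMl ?lerDl// sumr_ge0.
    rewrite subrr normr0 mulr_ge0 ?addr_ge0 ?exprn_ge0 ?sumr_ge0//; split=> //.
    by rewrite (le_trans (hx i))// ler_wpDl// ler_norm.
- exists (fun k e => g1 k e + g2 k e); split=> [k|z dz t hz|rho].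
  + exact: polyfun_add.
  + under eq_bigr do rewrite mulrDl.
    by rewrite big_split/=; exact: is_deriveD (c1 _ _ _ hz) (c2 _ _ _ hz).
  + have [C1 C10 h1] := t1 rho; have [C2 C20 h2] := t2 rho.
    exists (C1 + C2) => [|x y hx hy /=]; first by rewrite addr_ge0.
    have [a1 a2 a3 a4] := h1 x y hx hy; have [b1 b2 b3 b4] := h2 x y hx hy.
    have -> : \sum_k (g1 k x + g2 k x) * (y k - x k) =
        \sum_k g1 k x * (y k - x k) + \sum_k g2 k x * (y k - x k).
      by rewrite -big_split; apply: eq_bigr => k _; rewrite mulrDl.
    rewrite !mulrDl; split.
    * exact: le_trans (ler_normD _ _) (lerD _ _).
    * rewrite opprD addrACA; exact: le_trans (ler_normD _ _) (lerD _ _).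
    * exact: le_trans (ler_normD _ _) (lerD _ _).
    * apply: le_trans (lerD a4 b4); apply: le_trans (ler_normD _ _).
      by rewrite le_eqVlt; apply/orP; left; apply/eqP; congr (`|_|); ring.
- exists (fun k e => f1 e * g2 k e + f2 e * g1 k e); split=> [k|z dz t hz|rho].
  + by apply: polyfun_add; exact: polyfun_mul.
  + under eq_bigr do rewrite mulrDl -!mulrA.
    rewrite big_split/= -!mulr_sumr.
    exact: is_deriveM (c1 _ _ _ hz) (c2 _ _ _ hz).
  + have [C1 C10 h1] := t1 rho; have [C2 C20 h2] := t2 rho.
    exists (C1 * C2 *+ 3) => [|x y hx hy]; first by rewrite mulrn_wge0// mulr_ge0.
    have [a1 a2 a3 a4] := h1 x y hx hy; have [b1 b2 b3 b4] := h2 x y hx hy.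
    have [a1' _ _ _] := h1 y x hy hx.
    rewrite /=; have -> : \sum_k (f1 x * g2 k x + f2 x * g1 k x) * (y k - x k) =
        f1 x * (\sum_k g2 k x * (y k - x k)) + f2 x * \sum_k g1 k x * (y k - x k).
      rewrite !mulr_sumr -big_split; apply: eq_bigr => k _ /=.
      by rewrite mulrDl !mulrA.
    move: a1 a2 a3 a4 b1 b2 b3 b4 a1' => /=.
    have : 0 <= \sum_k `|y k - x k| by rewrite sumr_ge0.
    move: (\sum_k `|y k - x k|) (\sum_k g1 k x * _) (\sum_k g2 k x * _).
    move=> D S1 S2 D0 a1 a2 a3 a4 b1 b2 b3 b4 a1'.
    have P (p q a b : R) : `|p| <= a -> `|q| <= b -> `|p * q| <= a * b.
      by move=> pa qb; rewrite normrM ler_pM.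
    have C120 : 0 <= C1 * C2 by rewrite mulr_ge0.
    have C12D : 0 <= C1 * C2 * D by rewrite mulr_ge0.
    split.
    * by apply: le_trans (P _ _ _ _ a1 b1) _; lra.
    * have -> : f1 y * f2 y - f1 x * f2 x =
        f1 y * (f2 y - f2 x) + f2 x * (f1 y - f1 x) by ring.
      apply: le_trans (ler_normD _ _) _.
      by have := P _ _ _ _ a1' b2; have := P _ _ _ _ b1 a2; lra.
    * apply: le_trans (ler_normD _ _) _.
      by have := P _ _ _ _ a1 b3; have := P _ _ _ _ b1 a3; lra.
    (* Each of the three summands is a bounded factor times a quadratic remainder, or a product of
       two first-order terms, hence at most C1 C2 D^2. *)
    * have -> : f1 y * f2 y - f1 x * f2 x - (f1 x * S2 + f2 x * S1) =
        f1 y * (f2 y - f2 x - S2) + (f1 y - f1 x) * S2 +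
        f2 x * (f1 y - f1 x - S1) by ring.
      apply: le_trans (ler_normD _ _) _.
      apply: le_trans (lerD (ler_normD _ _) (lexx _)) _.
      have := P _ _ _ _ a1' b4; have := P _ _ _ _ a2 b3.
      by have := P _ _ _ _ b1 a4; lra.
Qed.

Fixpoint lexle (T : Type) (F : T -> ('I_m -> R) -> R) (s : seq T) x y : Prop :=
  if s is a :: s' then F a x < F a y \/ (F a x = F a y /\ lexle F s' x y)
  else Logic.True.

Lemma lexle_anti (T : eqType) (F : T -> ('I_m -> R) -> R) (s : seq T) x y :
  lexle F s x y -> lexle F s y x -> {in s, forall a, F a x = F a y}.
Proof.
elim: s => // a s IH /= [xy|[xy sxy]] [yx|[yx syx]] b.
- by have := lt_trans xy yx; rewrite ltxx.
- by move: xy; rewrite yx ltxx.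
- by move: yx; rewrite xy ltxx.
- by rewrite inE => /predU1P[->//|]; exact: IH.
Qed.

(** Minimize the first key; its minimizers in [K] form a sublevel set, again compact, on which the
    remaining keys are minimized in turn. *)
Lemma lexmin_exists (T : Type) (F : T -> ('I_m -> R) -> R) (s : seq T)
    (K : set 'rV[R]_m) :
  compact K -> K !=set0 ->
  (forall a, continuous (fun x : 'rV[R]_m => F a (x ord0))) ->
  exists2 x, K x & forall y : 'rV[R]_m, K y -> lexle F s (x ord0) (y ord0).
Proof.
move=> + + cF; elim: s K => [|a s IH] K cK K0; first by case: K0 => x Kx; exists x.
have [x Kx xmin] := compact_EVT_min K0 cK (continuous_subspaceT (cF a)).
have cL : compact (K `&` [set y : 'rV[R]_m | F a (y ord0) <= F a (x ord0)]).
  apply: compact_closedI => //.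
  by apply: (preimage_closed _ (@closed_le _ (F a (x ord0)))) => y _; exact: cF.
have [y [Ky /= yx] ymin] := IH _ cL (ex_intro _ x (conj (set_mem Kx) (lexx _))).
exists y => // z Kz /=; have [yz|zy] := ltP (F a (y ord0)) (F a (z ord0)).
  by left.
right; split; first by apply/le_anti; rewrite zy (le_trans yx)// xmin// inE.
by apply: ymin; split=> //=; exact: le_trans yx.
Qed.

End Gradient.

(** * Quantification over blocks of variables *)

Section DefinableVectors.
Context {R : realType} {m : nat}.
Implicit Types (A : (nat -> R) -> Prop) (e : nat -> R) (p : 'I_m -> R).

Definition upd e (o : nat) p (i : nat) : R :=
  if (i < o)%N then e i else oapp p (e i) (insub (i - o)%N).

Lemma upd_block e o p : (fun k : 'I_m => upd e o p (o + k)%N) = p.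
Proof.
apply/funext => k; rewrite /upd ltnNge leq_addr/= addKn insubT//= => h.
by congr p; exact: val_inj.
Qed.

Lemma upd_lt e o p i : (i < o)%N -> upd e o p i = e i.
Proof. by rewrite /upd => ->. Qed.

Lemma definable_exv o A : definable A ->
  definable (fun e => exists p, A (upd e o p)).
Proof.
move=> dA; have := definable_exn o m dA; congr definable.
have E e (x : nat -> R) p : (forall k : 'I_m, p k = x (o + k)%N) ->
    (fun i => if (o <= i < o + m)%N then x i else e i) = upd e o p.
  move=> px; apply/funext => i; rewrite /upd (ltnNge i o).
  have [oi|io] //= := leqP o i.
  have Eo : (i < o + m)%N = (i - o < m)%N by rewrite ltn_subLR.
  case: insubP => [k km /= Ek|/negbTE nm]; rewrite Eo ?km ?nm//.
  by rewrite px Ek subnKC.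
apply/funext => e; apply/propext; split=> [[x Ax]|[p Ap]].
  by exists (fun k => x (o + k)%N); rewrite -(E e x).
exists (upd e o p); rewrite (E _ _ p)// => k.
by rewrite -[in LHS](upd_block e o p).
Qed.

Lemma definable_allv o A : definable A ->
  definable (fun e => forall p, A (upd e o p)).
Proof.
move=> dA; have := definable_not (definable_exv o (definable_not dA)).
congr definable; apply/funext => e; apply/propext; split.
  by move=> H x; apply: contrapT => nA; apply: H; exists x.
by move=> H [x]; apply; exact: H.
Qed.

Lemma definable_lexle (T : Type) (F : T -> ('I_m -> R) -> R) (s : seq T) o o' :
  (forall a, polyfun (F a)) ->
  definable (fun e => lexle F s (fun k => e (o + k)%N) (fun k => e (o' + k)%N)).
Proof.
move=> pF; have pFo a u : polyfun (fun e : nat -> R => F a (fun k => e (u + k)%N)).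
  by apply: (@polyfun_comp R _ _ _ (fun (k : 'I_m) e => e (u + k)%N)) => // k;
     exact: polyfun_var.
elim: s => [|a s IH] /=.
  by exists (ord.Bool true).
by apply: definable_or; [exact: definable_lt|apply: definable_and => //;
  exact: definable_eq].
Qed.

End DefinableVectors.

(** * The Lojasiewicz inequality *)

(** The bound 1 + rho avoids a square root: either |x_k| <= 1, or |x_k| <= x_k^2. *)
Lemma le_norm_sumsq (R : realType) m (x : 'I_m -> R) (rho : R) k :
  \sum_k x k ^+ 2 <= rho -> `|x k| <= 1 + rho.
Proof.
move=> xrho; have xk : x k ^+ 2 <= rho.
  apply: le_trans xrho; rewrite (bigD1 k)//= lerDl sumr_ge0// => j _.
  exact: sqr_ge0.
have rho0 : 0 <= rho by apply: le_trans xk; exact: sqr_ge0.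
have [x1|x1] := leP `|x k| 1; first by rewrite (le_trans x1)// lerDl.
have : `|x k| <= x k ^+ 2 by rewrite -real_normK ?num_real// ler_eXnr// ltW.
by lra.
Qed.

Section Lojasiewicz.
Context {R : realType} {m : nat}.
Context (f G : ('I_m -> R) -> R) (rho : R) (pf : polyfun f) (pG : polyfun G).
Implicit Types (x y : 'I_m -> R) (t : R).

(* Indexed by the inverse of the value of [f], so that small values of [f] are
   reached as [t] tends to infinity. *)
Definition level t x : Prop := \sum_k x k ^+ 2 <= rho /\ t * f x = 1.

Definition key (a : option 'I_m) x : R := if a is Some k then x k else G x.

(* A minimizer of [G] on the level set, made unique by the lexicographic order
   on the coordinates. *)
Definition talweg t x : Prop := level t x /\
  forall y, level t y -> lexle key (None :: map Some (enum 'I_m)) x y.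

Lemma talweg_uniq t x y : talweg t x -> talweg t y -> x = y.
Proof.
move=> [lx xmin] [ly ymin]; apply/funext => k.
apply: (lexle_anti (xmin _ ly) (ymin _ lx) (_ : Some k \in _)).
by rewrite inE map_f ?orbT// mem_enum.
Qed.

Lemma talweg_min t x y : talweg t x -> level t y -> G x <= G y.
Proof. by move=> [_ xmin] /xmin /= [/ltW//|[->]]. Qed.

Lemma polyfun_key a : polyfun (key a).
Proof. by case: a => [k|//]; exact: polyfun_var. Qed.

Lemma compact_level t : compact [set x : 'rV[R]_m | level t (x ord0)].
Proof.
have cN : continuous (fun x : 'rV[R]_m => \sum_k x ord0 k ^+ 2).
  apply: (@polyfun_continuous R m (fun x => \sum_k x k ^+ 2)).
  by apply: polyfun_sum => k _; apply: polyfun_exp; exact: polyfun_var.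
have cf : continuous (fun x : 'rV[R]_m => t * f (x ord0)).
  apply: (@polyfun_continuous R m (fun x => t * f x)).
  by apply: polyfun_mul => //; exact: polyfun_cst.
apply: bounded_closed_compact.
  exists (1 + rho); split; first exact: num_real.
  move=> M rM x [/= xrho _].
  have rho0 : 0 <= rho by apply: le_trans xrho; rewrite sumr_ge0// => k _; exact: sqr_ge0.
  rewrite [leLHS]/Num.norm /= mx_normrE; apply/bigmax_leP; split=> [|[i k] _ /=].
    by rewrite (le_trans _ (ltW rM))// addr_ge0.
  by rewrite (ord1 i) (le_trans (le_norm_sumsq k xrho))// ltW.
rewrite (_ : [set _ | _] = [set x : 'rV[R]_m | \sum_k x ord0 k ^+ 2 <= rho] `&`
  [set x : 'rV[R]_m | t * f (x ord0) = 1])//.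
apply: closedI.
  by apply: (preimage_closed _ (@closed_le _ rho)) => y _; exact: cN.
by apply: (preimage_closed _ (@closed_eq _ 1)) => y _; exact: cf.
Qed.

Lemma talweg_exists t : (exists x, level t x) -> exists x, talweg t x.
Proof.
move=> [x lx].
have K0 : [set x : 'rV[R]_m | level t (x ord0)] !=set0.
  exists (\row_k x k) => /=.
  by rewrite (_ : _ ord0 = x)//; apply/funext => k; rewrite mxE.
have cF a : continuous (fun x : 'rV[R]_m => key a (x ord0)).
  exact/polyfun_continuous/polyfun_key.
have [y ly ymin] :=
  lexmin_exists (None :: map Some (enum 'I_m)) (compact_level (t:=t)) K0 cF.
exists (y ord0); split=> // z lz.
have Ez : (\row_k z k) ord0 = z by apply/funext => k; rewrite mxE.
by have := ymin (\row_k z k); rewrite /= Ez; exact.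
Qed.

Lemma polyfun_block (h : ('I_m -> R) -> R) o : polyfun h ->
  polyfun (fun e : nat -> R => h (fun k => e (o + k)%N)).
Proof.
move=> ph; apply: (@polyfun_comp R _ _ _ (fun (k : 'I_m) e => e (o + k)%N)) => //.
by move=> k; exact: polyfun_var.
Qed.

Lemma definable_level (tau : (nat -> R) -> R) o : polyfun tau ->
  definable (fun e => level (tau e) (fun k => e (o + k)%N)).
Proof.
move=> ptau; apply: definable_and.
  apply: definable_le; last exact: polyfun_cst.
  by apply: polyfun_sum => k _; apply: polyfun_exp; exact: polyfun_var.
apply: definable_eq; last exact: polyfun_cst.
by apply: polyfun_mul => //; exact: polyfun_block.
Qed.

(** The competitors [y] of a talweg point are quantified in the block at [o'], which must therefore
    lie past the block of [x] and be invisible to [tau]. *)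
Lemma definable_talweg (tau : (nat -> R) -> R) o o' : polyfun tau ->
  (o + m <= o')%N -> (forall e (p : 'I_m -> R), tau (upd e o' p) = tau e) ->
  definable (fun e => talweg (tau e) (fun k => e (o + k)%N)).
Proof.
move=> ptau oo' tauE; apply: definable_and; first exact: definable_level.
have := definable_allv (m := m) o' (definable_imply (definable_level o' ptau)
  (definable_lexle (None :: map Some (enum 'I_m)) o o' polyfun_key)).
congr definable; apply/funext => e.
suff E (p : 'I_m -> R) : (fun k : 'I_m => upd e o' p (o + k)%N) = fun k => e (o + k)%N.
  by apply/propext; split=> H p; have := H p; rewrite tauE upd_block E.
apply/funext => k; rewrite upd_lt//.
by apply: leq_trans oo'; rewrite ltn_add2l.
Qed.

(** Talweg points being unique, binding them existentially defines the graph of the scaled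
    increment. *)
Lemma definable_increment (k : 'I_m) : exists2 A : (nat -> R) -> Prop,
  definable A & forall t u x y, talweg t x -> talweg (t + 1) y ->
    A (nth 0 [:: t; u]) <-> u = t * (y k - x k).
Proof.
have ptau0 : polyfun (fun e : nat -> R => e 0%N) by exact: polyfun_var.
have ptau1 : polyfun (fun e : nat -> R => e 0%N + 1).
  by apply: polyfun_add => //; exact: polyfun_cst.
have lt0 i (e : nat -> R) (p : 'I_m -> R) : upd e (2 + m + i) p 0%N = e 0%N.
  exact: upd_lt.
(* Layout of the environment: [t] at 0, [u] at 1, the points at parameters t and t + 1 from 2 and 2
   + m on, and the competitors from 2 + m + m on. *)
pose B (e : nat -> R) := (talweg (e 0%N) (fun k => e (2 + k)%N) /\
  talweg (e 0%N + 1) (fun k => e (2 + m + k)%N)) /\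
  e 1%N = e 0%N * (e (2 + m + k)%N - e (2 + k)%N).
have dB : definable B.
  apply: definable_and; first apply: definable_and.
  - apply: (@definable_talweg _ _ (2 + m + m) ptau0) => [|e p].
      by rewrite leq_addr.
    exact: lt0.
  - apply: (@definable_talweg _ _ (2 + m + m) ptau1) => [|e p].
      exact: leqnn.
    by congr (_ + 1); exact: lt0.
  - apply: definable_eq; first exact: polyfun_var.
    by apply: polyfun_mul => //; apply: polyfun_sub; exact: polyfun_var.
exists (fun e => exists p : 'I_m -> R, exists q : 'I_m -> R, B (upd (upd e 2 p) (2 + m) q)).
  exact: definable_exv (definable_exv (2 + m) dB).
move=> t u x y tx ty; set e := nth 0 _.
have BE (p q : 'I_m -> R) : B (upd (upd e 2 p) (2 + m) q) <->
    (talweg t p /\ talweg (t + 1) q) /\ u = t * (q k - p k).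
  have Ep : (fun k : 'I_m => upd (upd e 2 p) (2 + m) q (2 + k)%N) = p.
    rewrite -[RHS](upd_block e 2 p); apply/funext => j.
    by rewrite upd_lt// ltn_add2l.
  have Eq := upd_block (upd e 2 p) (2 + m) q.
  rewrite /B Ep Eq (congr1 (@^~ k) Ep) (congr1 (@^~ k) Eq).
  by rewrite [upd _ (2 + m) q 0]upd_lt// [upd _ (2 + m) q 1]upd_lt.
split=> [[p [q /BE[[tp tq]]]]|Eu].
  by rewrite (talweg_uniq tp tx) (talweg_uniq tq ty).
by exists x, y; apply/BE.
Qed.

Lemma increment_decay (gamma : R -> 'I_m -> R) (k : 'I_m) :
  (\forall t \near +oo, talweg t (gamma t)) ->
  (forall t, `|gamma t k| <= 1 + rho) ->
  exists (C : R) (j : nat), [/\ 0 < C, (0 < j)%N &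
    \forall t \near +oo, `|t * (gamma (t + 1) k - gamma t k)| ^+ j <= C / t].
Proof.
move=> [M [_ HM]] Hb; have [A dA HA] := definable_increment k.
pose h t := t * (gamma (t + 1) k - gamma t k).
have Ah t u : M < t -> A (nth 0 [:: t; u]) <-> u = h t.
  by move=> Mt; apply: HA; apply: HM => //=; rewrite ltr_wpDr.
have Mnear : \forall t \near +oo, M < t by apply: nbhs_pinfty_gt; exact: num_real.
have [Q Q0 HQ] := definable_algebraic dA.
have [eps [C [j [eps0 C0 j0 HC]]]] := algebraic_decay Q0.
have consE (t y : R) :
    ([eta nth 0 [:: t] with 1%N |-> y] : nat -> R) = nth 0 [:: t; y].
  by apply/funext => -[|[|i]] //=; rewrite nth_nil.
(* A definable condition on h(t) eventually always holds or eventually always fails; [h] enters only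
   through its definable graph [A]. *)
have big (P : R -> Prop) : definable (fun e => P (e 1%N)) ->
    (\forall t \near +oo, P (h t)) \/ (\forall t \near +oo, ~ P (h t)).
  move=> dP; have AhP t : M < t ->
      (exists y : R, A [eta nth 0 [:: t] with 1%N |-> y] /\ P y) <-> P (h t).
    move=> Mt; split=> [[y]|Pt]; first by rewrite consE => -[/(Ah _ _ Mt)->].
    by exists (h t); rewrite consE; split=> //; exact/Ah.
  have [H|H] := definable_dichotomy (definable_ex 1 (definable_and dA dP));
    [left|right]; apply: filterS2 Mnear H => t Mt; first by move=> /(AhP _ Mt).
  by move=> nH /(AhP _ Mt).
have pe1 : polyfun (fun e : nat -> R => e 1%N) by exact: polyfun_var.
have [H|Hpos] := big (fun a => eps <= a)
    (definable_le (polyfun_cst _ eps) pe1).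
  by case: (bounded_increment eps0 Hb H).
have [H|Hneg] := big (fun a => a <= - eps)
    (definable_le pe1 (polyfun_cst _ (- eps))).
  (* The case h <= -eps is excluded by applying the divergence argument to -gamma. *)
  have /(bounded_increment eps0) : forall t, `|- gamma t k| <= 1 + rho.
    by move=> t; rewrite normrN.
  case; apply: filterS H => t.
  by rewrite /h lerNr -mulrN opprB addrC opprK.
exists C, j; split=> //; near=> t.
apply: HC; first by near: t; apply: nbhs_pinfty_ge; exact: num_real.
  apply: HQ => u; apply: Ah.
  by near: t.
have /negP : ~ (eps <= h t) by near: t.
have /negP : ~ (h t <= - eps) by near: t.
by rewrite -!ltNge ltr_norml => -> ->.
Unshelve. all: by end_near. Qed.

End Lojasiewicz.

Theorem lojasiewicz (R : realType) m (f : ('I_m -> R) -> R)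
    (g : 'I_m -> ('I_m -> R) -> R) (rho : R) :
  polyfun f -> (forall k, polyfun (g k)) -> taylor_bound f g ->
  exists b C delta : R, [/\ 0 < b, 0 < C, 0 < delta &
    forall x : 'I_m -> R, \sum_k x k ^+ 2 <= rho -> 0 < f x < delta ->
      f x <= C * f x `^ b * Num.sqrt (\sum_k g k x ^+ 2)].
Proof.
move=> pf pg tg; pose G x := \sum_k g k x ^+ 2.
have pG : polyfun G.
  by apply: polyfun_sum => k _; exact: polyfun_exp.
have dE : definable (fun e : nat -> R => exists p : 'I_m -> R,
    level f rho (upd e 1 p 0%N) (fun k => upd e 1 p (1 + k)%N)).
  apply: (@definable_exv R m 1 (fun e => level f rho (e 0%N) (fun k => e (1 + k)%N))).
  exact: definable_level (polyfun_var _ _).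
(* A value of [f] below this threshold has its inverse, the parameter of its level, beyond [M]. *)
have invlt (M t : R) : 0 < t < (Num.max M 0 + 1)^-1 -> M < t^-1.
  move=> /andP[t0 tM]; have M0 : 0 < Num.max M 0 + 1.
    by rewrite ltr_wpDl// le_max lexx orbT.
  rewrite (@lt_trans _ _ (Num.max M 0 + 1))//.
    by rewrite (@le_lt_trans _ _ (Num.max M 0)) ?le_max ?lexx// ltrDl.
  by rewrite -[ltLHS]invrK ltf_pV2 ?posrE ?invr_gt0.
have dpos (M : R) : 0 < (Num.max M 0 + 1)^-1.
  by rewrite invr_gt0 ltr_wpDl// le_max lexx orbT.
have lev (x : 'I_m -> R) : \sum_k x k ^+ 2 <= rho -> 0 < f x ->
    level f rho (f x)^-1 x.
  by move=> xr fx; split=> //; rewrite mulVf// gt_eqF.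
(* The levels 1/t meet the ball either for all large t or for no large t. In the second case a small
   enough delta leaves no point to treat. *)
have [[M [_ HM]]|[M [_ HM]]] := definable_dichotomy dE; last first.
  exists 1, 1, (Num.max M 0 + 1)^-1; split=> // x xr fx.
  case: (HM (f x)^-1); first exact: invlt.
  exists x; rewrite upd_lt// upd_block; apply: lev => //.
  by case/andP: fx.
have {}HM t : M < t -> exists x, talweg f G rho t x.
  by move=> /HM[p]; rewrite upd_lt// upd_block => lp; apply: talweg_exists => //; exists p.
have [x0 Hx0] := HM (M + 1) (ltr_pwDr ltr01 (lexx _)).
(* Up to [M], [gamma] takes the default value [x0], so that it is bounded on the whole line. *)
have /choice[gamma Hgamma] : forall t, exists x, (M < t -> talweg f G rho t x) /\
    \sum_k x k ^+ 2 <= rho.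
  move=> t; have [Mt|tM] := ltP M t.
    by have [x Hx] := HM _ Mt; exists x; split=> //; case: Hx => -[].
  by exists x0; split=> //; case: Hx0 => -[].
have tgam : \forall t \near +oo, talweg f G rho t (gamma t).
  by exists M; split; [exact: num_real|move=> t Mt; apply (Hgamma t).1].
have gamb t k : `|gamma t k| <= 1 + rho.
  by apply: le_norm_sumsq; exact: (Hgamma t).2.
have [C2 C20 HC2] := tg (1 + rho).
pose h (t : R) k : R := t * (gamma (t + 1) k - gamma t k).
have /choice[Cs /choice[js Hd]] : forall k, exists (C : R) (j : nat), [/\ 0 < C, (0 < j)%N &
    \forall t \near +oo, `|h t k| ^+ j <= C / t].
  move=> k; exact: (increment_decay pf pG tgam (gamb^~ k)).
(* [J] exceeds every [js k], so that one exponent b = 1/J serves all coordinates once |h_k| <= 1. *)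
pose J := (\sum_k js k).+1; pose b : R := J%:R^-1.
pose Cc := 1 + \sum_k Cs k.
have Cc0 : 0 < Cc by rewrite ltr_pwDl// sumr_ge0// => k _; case: (Hd k) => /ltW.
(* If every |h_k| is at most eps, their sum w is at most 1/(2(C2 + 1)), which absorbs the quadratic
   Taylor remainder. *)
pose eps : R := (2 * (m%:R + 1) * (C2 + 1))^-1.
have m0 : 0 <= m%:R :> R by [].
have eps0 : 0 < eps by rewrite invr_gt0 !mulr_gt0// ltr_wpDl.
have eps1 : eps <= 1.
  rewrite invf_le1 ?mulr_gt0 ?ltr_wpDl//.
  by rewrite -[1]mul1r ler_pM// ?lerDr//; lra.
have hsmall k : \forall t \near +oo, `|h t k| <= eps.
  have [Ck jk Hk] := Hd k; near=> t.
  have t0 : 0 < t by near: t; apply: nbhs_pinfty_gt; exact: num_real.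
  rewrite -(ler_pXn2r jk) ?nnegrE ?(ltW eps0)//.
  apply: le_trans (_ : Cs k / t <= _); first by near: t.
  rewrite ler_pdivrMr// mulrC -ler_pdivrMr ?exprn_gt0//.
have hdecay k : \forall t \near +oo, `|h t k| <= Cc `^ b * t^-1 `^ b.
  have [Ck jk Hk] := Hd k; near=> t.
  have t0 : 0 < t by near: t; apply: nbhs_pinfty_gt; exact: num_real.
  have h1 : `|h t k| <= 1 by apply: le_trans eps1; near: t.
  rewrite -powRM ?invr_ge0 ?(ltW t0) ?(ltW Cc0)//.
  have -> : `|h t k| = (`|h t k| ^+ J) `^ b.
    by rewrite -powR_mulrn// -powRrM /b divff ?powRr1// pnatr_eq0.
  apply: ge0_ler_powR; rewrite ?invr_ge0 ?nnegrE ?exprn_ge0//.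
    by rewrite divr_ge0// ltW.
  apply: le_trans (_ : `|h t k| ^+ js k <= _).
    by rewrite ler_wiXn2l// /J (bigD1 k)//= leqW// leq_addr.
  apply: le_trans (_ : Cs k / t <= _); first by near: t.
  rewrite ler_pM2r ?invr_gt0// /Cc ler_wpDl// (bigD1 k)//= lerDl sumr_ge0// => l _.
  by case: (Hd l) => /ltW.
(* With D = w/t, Taylor's formula times t^2 gives 1/2 <= t |grad f| w + C2 w^2. The last term is at
   most 1/4, and w decays like t^(-b). *)
have key_ineq : \forall t \near +oo,
    t^-1 <= 4 * (m%:R + 1) * Cc `^ b * t^-1 `^ b * Num.sqrt (G (gamma t)).
  near=> t.
  have t1 : 1 <= t by near: t; apply: nbhs_pinfty_ge; exact: num_real.
  have t0 : 0 < t by exact: lt_le_trans t1.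
  have Mt : M < t by near: t; apply: nbhs_pinfty_gt; exact: num_real.
  have hs k : `|h t k| <= eps.
    by move: k; near: t; apply: filter_forall.
  have hd k : `|h t k| <= Cc `^ b * t^-1 `^ b.
    by move: k; near: t; apply: filter_forall.
  have [_ lX] := ((Hgamma t).1 Mt).1.
  have [_ lY] := ((Hgamma (t + 1)).1 (lt_trans Mt (ltr_pwDr ltr01 (lexx t)))).1.
  have := HC2 (gamma t) (gamma (t + 1)) (gamb t) (gamb (t + 1)).
  set D := \sum_k _; set S := \sum_k _; move=> /= [_ _ _ rem].
  pose w := \sum_k `|h t k|.
  have w0 : 0 <= w by rewrite sumr_ge0.
  have Dw : D = w / t.
    rewrite /D /w mulr_suml; apply: eq_bigr => k _.
    by rewrite /h normrM (gtr0_norm t0) mulrAC divff ?gt_eqF// mul1r.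
  have SD : `|S| <= Num.sqrt (G (gamma t)) * D.
    rewrite (le_trans (ler_norm_sum _ _ _))// mulr_sumr ler_sum// => k _.
    rewrite normrM ler_wpM2r// -sqrtr_sqr ler_wsqrtr// /G (bigD1 k)//= lerDl.
    by rewrite sumr_ge0// => l _; exact: sqr_ge0.
  have wm (c : R) : (forall k, `|h t k| <= c) -> w <= m%:R * c.
    move=> hc; rewrite /w; apply: le_trans (ler_sum _ (fun k _ => hc k)) _.
    by rewrite sumr_const card_ord mulr_natl.
  have wsmall : C2 * w ^+ 2 <= 4^-1.
    have we : w * (2 * (C2 + 1)) <= 1.
      apply: le_trans (ler_wpM2r _ (wm _ hs)) _; first by rewrite mulr_ge0// addr_ge0.
      have -> : m%:R * eps * (2 * (C2 + 1)) = m%:R / (m%:R + 1).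
        by rewrite /eps; field; rewrite !gt_eqF// ltr_wpDl.
      by rewrite ler_pdivrMr ?ltr_wpDl// mul1r lerDl.
    (* From (C2 + 1) w <= 1/2 follows C2 w^2 <= w/2 - w^2 = 1/16 - (w - 1/4)^2. *)
    have : C2 * w * w <= (2^-1 - w) * w by rewrite ler_wpM2r//; lra.
    by have := sqr_ge0 (w - 4^-1); lra.
  have fX : f (gamma t) = t^-1.
    by apply: (mulfI (lt0r_neq0 t0)); rewrite lX divff// gt_eqF.
  have t10 : 0 < t + 1 by rewrite addr_gt0.
  have fY : f (gamma (t + 1)) = (t + 1)^-1.
    by apply: (mulfI (lt0r_neq0 t10)); rewrite lY divff// gt_eqF.
  have lhs : (2 * t ^+ 2)^-1 <= `|f (gamma (t + 1)) - f (gamma t)|.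
    rewrite fX fY distrC (_ : t^-1 - _ = (t * (t + 1))^-1); last first.
      by field; rewrite !gt_eqF.
    rewrite gtr0_norm ?invr_gt0 ?mulr_gt0// lef_pV2 ?posrE ?mulr_gt0 ?exprn_gt0//.
    by rewrite expr2 mulrCA ler_pM2l//; lra.
  have : (2 * t ^+ 2)^-1 <= Num.sqrt (G (gamma t)) * D + C2 * D ^+ 2.
    apply: le_trans lhs _; rewrite -[X in `|X|](subrK S).
    by apply: le_trans (ler_normD _ _) _; rewrite addrC lerD.
  rewrite Dw => /(ler_wpM2l (ltW (exprn_gt0 2 t0))).
  have -> : t ^+ 2 * (2 * t ^+ 2)^-1 = 2^-1 by field; rewrite gt_eqF.
  have -> : t ^+ 2 * (Num.sqrt (G (gamma t)) * (w / t) + C2 * (w / t) ^+ 2) =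
    t * Num.sqrt (G (gamma t)) * w + C2 * w ^+ 2 by field; rewrite gt_eqF.
  move=> main; have {main} : 1 <= 4 * (t * Num.sqrt (G (gamma t)) * w) by lra.
  move=> main; rewrite -[leLHS]mul1r ler_pdivrMr//.
  apply: le_trans main _.
  have wd : w <= (m%:R + 1) * (Cc `^ b * t^-1 `^ b).
    apply: le_trans (wm _ hd) _.
    by rewrite ler_wpM2r ?mulr_ge0 ?powR_ge0// lerDl.
  have tG : 0 <= 4 * (t * Num.sqrt (G (gamma t))).
    by rewrite !mulr_ge0// ltW.
  by have := ler_wpM2l tG wd; lra.
have [M' [_ HM']] := key_ineq.
pose M'' := Num.max M M'.
exists b, (4 * (m%:R + 1) * Cc `^ b), (Num.max M'' 0 + 1)^-1; split.
- by rewrite invr_gt0 ltr0n.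
- have m10 : 0 < m%:R + 1 :> R by rewrite ltr_wpDl.
  by rewrite mulr_gt0 ?powR_gt0// mulr_gt0.
- exact: dpos.
move=> x xr fx; have /andP[fx0 _] := fx.
have := invlt _ _ fx; rewrite gt_max => /andP[Mx M'x].
(* At the parameter 1/f(x), [gamma] minimizes |grad f| on the level of [x], so the bound along
   [gamma] transfers to [x]. *)
have := HM' _ M'x; rewrite invrK => /le_trans; apply.
rewrite ler_wpM2l ?mulr_ge0 ?powR_ge0 ?addr_ge0// ler_wsqrtr//.
exact: talweg_min ((Hgamma _).1 Mx) (lev _ xr fx0).
Unshelve. all: by end_near. Qed.

(** * Gradient flows of polynomials *)

Section GradientFlow.
Context {R : realType}.

Lemma is_derive_le0_nincr (h dh : R -> R) (T : R) :
  (forall t, T <= t -> is_derive t (1 : R) h (dh t)) ->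
  (forall t, T <= t -> dh t <= 0) ->
  forall s t, T <= s -> s <= t -> h t <= h s.
Proof.
move=> hd hle s t Ts st.
have [||c] := @MVT_segment R h dh s t st.
- by move=> x; rewrite in_itv/= => /andP[sx _]; apply: hd; rewrite (le_trans Ts)// ltW.
- apply: derivable_within_continuous => x; rewrite in_itv/= => /andP[sx _].
  by have [] := hd x (le_trans Ts sx).
rewrite in_itv/= => /andP[sc ct] E.
rewrite -subr_le0 E mulr_le0_ge0 ?subr_ge0//.
by apply: hle; rewrite (le_trans Ts)// ltW.
Qed.

Lemma nincr_bounded_cvg (h : R -> R) (T B : R) :
  (forall s t, T <= s -> s <= t -> h t <= h s) ->
  (forall t, T <= t -> B <= h t) ->
  exists l : R, h t @[t --> +oo] --> l.
Proof.
(* Freezing the argument at [T] makes the monotonicity global. *)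
move=> hdec hB; pose f t := - h (Num.max t T).
have fnd : nondecreasing_fun f.
  move=> s t st; rewrite /f lerN2 hdec//; first by rewrite le_max lexx orbT.
  by rewrite ge_max !le_max st lexx !orbT.
have fub : has_ubound (range f).
  exists (- B) => _ [t _ <-]; rewrite /f lerN2 hB//.
  by rewrite le_max lexx orbT.
exists (- sup (range f)).
have /cvgN := nondecreasing_cvgr fnd fub; apply: cvg_trans.
apply: near_eq_cvg; near=> t; rewrite /f opprK max_l//.
Unshelve. all: by end_near. Qed.

Lemma is_derive_le0_cvg (h dh : R -> R) (T B : R) :
  (forall t, T <= t -> is_derive t (1 : R) h (dh t)) ->
  (forall t, T <= t -> dh t <= 0) -> (forall t, T <= t -> B <= h t) ->
  exists l : R, h t @[t --> +oo] --> l.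
Proof.
move=> hd hle; apply: nincr_bounded_cvg => s t.
exact: is_derive_le0_nincr hd hle s t.
Qed.

(** By the Lojasiewicz inequality, (f^b)' <= -(b/C) |grad f| along the flow, while |z_k'| <= |grad
    f|. Hence f^b and z_k + (C/b) f^b are both nonincreasing and bounded below, and their limits
    give that of z_k. *)
Lemma gradient_flow_cvg m (f : ('I_m -> R) -> R) (g : 'I_m -> ('I_m -> R) -> R)
    (z : 'I_m -> R -> R) (rho T0 : R) :
  polyfun f -> (forall k, polyfun (g k)) -> chain_rule f g -> taylor_bound f g ->
  (forall x, 0 <= f x) ->
  (forall t, T0 <= t -> forall k, is_derive t (1 : R) (z k) (- g k (z^~ t))) ->
  (forall t, T0 <= t -> \sum_k z k t ^+ 2 <= rho) ->
  f (z^~ t) @[t --> +oo] --> (0 : R) ->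
  exists l : 'I_m -> R, forall k, z k t @[t --> +oo] --> l k.
Proof.
move=> pf pg cg tg f0 dz zrho fz0.
have [b [C [delta [b0 C0 delta0 loj]]]] := lojasiewicz rho pf pg tg.
pose G t := \sum_k g k (z^~ t) ^+ 2.
have G0 t : 0 <= G t by rewrite sumr_ge0// => k _; exact: sqr_ge0.
pose phi t := f (z^~ t).
have dphi t : T0 <= t -> is_derive t (1 : R) phi (- G t).
  move=> Tt; apply: is_derive_eq (cg z (fun k => - g k (z^~ t)) t (dz t Tt)) _.
  by rewrite /G -sumrN; apply: eq_bigr => k _; rewrite mulrN expr2.
have phidec : forall s t, T0 <= s -> s <= t -> phi t <= phi s.
  by apply: is_derive_le0_nincr dphi _ => t _; rewrite oppr_le0.
have zb t k : T0 <= t -> `|z k t| <= 1 + rho.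
  by move=> Tt; apply: (@le_norm_sumsq _ _ (z^~ t)); exact: zrho.
have gG t k : `|g k (z^~ t)| <= Num.sqrt (G t).
  rewrite -sqrtr_sqr ler_wsqrtr// /G (bigD1 k)//= lerDl.
  by rewrite sumr_ge0// => l _; exact: sqr_ge0.
suff H k : exists l : R, z k t @[t --> +oo] --> l.
  by have /choice[l Hl] := H; exists l.
have [[T1 T01 phiT1]|pos] := pselect (exists2 t, T0 <= t & phi t = 0).
  (* Once [phi] vanishes it stays zero, so its derivative [- G] vanishes too
     and the trajectory is stationary. *)
  have G_eq0 t : T1 < t -> G t = 0.
    move=> T1t; have phi_near : \forall s \near t, 0 = phi s.
      near=> s; apply/eqP; rewrite eq_le f0 -phiT1 phidec// ltW//.
      by near: s; exact: lt_nbhsr.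
    have [_ Dphi] := dphi t (le_trans T01 (ltW T1t)).
    have [_ D0] := near_eq_is_derive phi_near (is_derive_cst (0 : R) t (1 : R)).
    by apply/eqP; rewrite -oppr_eq0 -Dphi D0.
  (* Starting at T1 + 1 keeps t strictly past T1, where [phi] vanishes on a neighbourhood of t. *)
  apply: (@is_derive_le0_cvg _ (fun t => - g k (z^~ t)) (T1 + 1) (- (1 + rho))) => t T1t.
  - by apply: dz; lra.
  - have T1t' : T1 < t by lra.
    have := gG t k; rewrite (G_eq0 _ T1t') sqrtr0 normr_le0 => /eqP->.
    by rewrite oppr0.
  - have T0t : T0 <= t by lra.
    by have := zb t k T0t; rewrite ler_norml => /andP[].
have phi_gt0 t : T0 <= t -> 0 < phi t.
  by move=> Tt; rewrite lt_def f0 andbT; apply/eqP => E; apply: pos; exists t.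
have [T [T0T Hdelta]] : exists T, T0 <= T /\ forall t, T <= t -> phi t < delta.
  have [M [_ HM]] := cvgr_lt _ fz0 _ delta0.
  exists (Num.max T0 (M + 1)); split; first by rewrite le_max lexx.
  by move=> t; rewrite ge_max => /andP[_ Mt]; apply: HM; rewrite /=; lra.
pose H t := phi t `^ b.
have dH t : T <= t -> is_derive t (1 : R) H (b * phi t `^ (b - 1) * - G t).
  move=> Tt; have Tt0 := le_trans T0T Tt.
  exact: is_derive1_comp (is_derive1_powR b (phi_gt0 t Tt0)) (dphi t Tt0).
(* Since f^(b-1) |grad f|^2 = (f^b |grad f| / f) |grad f|, the inequality f <= C f^b |grad f| bounds
   it below by |grad f| / C. *)
have dHle t : T <= t -> b * phi t `^ (b - 1) * - G t <= - (b / C * Num.sqrt (G t)).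
  move=> Tt; have p0 := phi_gt0 _ (le_trans T0T Tt).
  have -> : phi t `^ (b - 1) = H t / phi t.
    rewrite powRB; last by rewrite (gt_eqF p0) implybT.
    by rewrite powRr1// ltW.
  have := loj (z^~ t) (zrho _ (le_trans T0T Tt)).
  rewrite -/(phi t) -/(G t) -/(H t) p0 Hdelta// => /(_ isT) lojt.
  have {lojt} : Num.sqrt (G t) * phi t <= C * H t * Num.sqrt (G t) * Num.sqrt (G t).
    by rewrite mulrC ler_wpM2r ?sqrtr_ge0.
  rewrite -mulrA -[Num.sqrt _ * Num.sqrt _]expr2 sqr_sqrtr// => lojt.
  have sHG : Num.sqrt (G t) / C <= H t * G t / phi t.
    by rewrite ler_pdivlMr// mulrAC ler_pdivrMr//; lra.
  rewrite mulrN lerN2 [leRHS](_ : _ = b * (H t * G t / phi t)); last by ring.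
  by rewrite -mulrA ler_pM2l// mulrC.
have [lH HlH] : exists l : R, H t @[t --> +oo] --> l.
  apply: is_derive_le0_cvg dH _ (fun t _ => powR_ge0 _ _) => t Tt.
  apply: le_trans (dHle t Tt) _.
  by rewrite oppr_le0 mulr_ge0 ?sqrtr_ge0// divr_ge0 ?ltW.
have [lK HlK] : exists l : R, (z k + (C / b) \*: H) t @[t --> +oo] --> l.
  apply: (@is_derive_le0_cvg _ (fun t => - g k (z^~ t) +
     (C / b) *: (b * phi t `^ (b - 1) * - G t)) T (- (1 + rho))) => t Tt.
  - by have := dz t (le_trans T0T Tt) k; have := dH t Tt => ? ?; exact: is_deriveD.
  - have : C / b * (b * phi t `^ (b - 1) * - G t) <=
        C / b * - (b / C * Num.sqrt (G t)).
      by rewrite ler_pM2l ?divr_gt0//; exact: dHle.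
    have -> : C / b * - (b / C * Num.sqrt (G t)) = - Num.sqrt (G t).
      by field; rewrite !gt_eqF.
    have := gG t k; rewrite ler_norml => /andP[+ _].
    rewrite /GRing.scale/=; lra.
  - have := zb t k (le_trans T0T Tt); rewrite ler_norml => /andP[zk _].
    rewrite (le_trans zk)// lerDl; apply: mulr_ge0; last exact: powR_ge0.
    by rewrite divr_ge0 ?ltW.
exists (lK - C / b * lH).
have <- : z k + (C / b) \*: H - cst (C / b) * H = z k.
  by apply/funext => t; rewrite !fctE /= addrK.
exact: cvgB HlK (cvgM (cvg_cst (C / b)) HlH).
Unshelve. all: by end_near. Qed.

Lemma polyfun_cvg (I T : Type) (F : set_system T) (f : (I -> R) -> R)
    (z : I -> T -> R) (l : I -> R) : Filter F -> polyfun f ->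
  (forall i, z i t @[t --> F] --> l i) -> f (z^~ t) @[t --> F] --> f l.
Proof.
move=> FF + zl; elim=> [c|i|f1 f2 _ + _|f1 f2 _ + _].
- exact: cvg_cst.
- exact: zl.
- by move=> h1 h2; exact: cvgD h1 h2.
- by move=> h1 h2; exact: cvgM h1 h2.
Qed.

(* Along the flow, Euler's identity makes the squared norm plus
   [2 c (t - T0) f] nonincreasing. *)
Lemma homogeneous_gradient_flow_cvg m (f : ('I_m -> R) -> R)
    (g : 'I_m -> ('I_m -> R) -> R) (z : 'I_m -> R -> R) (T0 c : R) :
  polyfun f -> (forall k, polyfun (g k)) -> chain_rule f g -> taylor_bound f g ->
  (forall x, 0 <= f x) -> 0 < c ->
  (forall x, \sum_k g k x * x k = c * f x) ->
  (forall t, T0 <= t -> forall k, is_derive t (1 : R) (z k) (- g k (z^~ t))) ->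
  exists2 l : 'I_m -> R, forall k, z k t @[t --> +oo] --> l k & f l = 0.
Proof.
move=> pf pg cg tg f0 c0 euler dz.
pose q t := \sum_k z k t ^+ 2.
have q0 t : 0 <= q t by rewrite sumr_ge0// => k _; exact: sqr_ge0.
pose phi t := f (z^~ t).
have p0 t : 0 <= phi t by exact: f0.
pose G t := \sum_k g k (z^~ t) ^+ 2.
have G0 t : 0 <= G t by rewrite sumr_ge0// => k _; exact: sqr_ge0.
have dphi t : T0 <= t -> is_derive t (1 : R) phi (- G t).
  move=> Tt; apply: is_derive_eq (cg z (fun k => - g k (z^~ t)) t (dz t Tt)) _.
  by rewrite /G -sumrN; apply: eq_bigr => k _; rewrite mulrN expr2.
have dq t : T0 <= t -> is_derive t (1 : R) q (- (2 * c * phi t)).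
  move=> Tt; rewrite (_ : q = \sum_k (z k ^+ 2)); last first.
    by apply/funext => s; rewrite fct_sumE; apply: eq_bigr => k _; rewrite fctE.
  have dX k : is_derive t (1 : R) (z k ^+ 2)
      ((2%:R * z k t ^+ 1) *: - g k (z^~ t)).
    by have := dz t Tt k => ?; exact: is_deriveX.
  apply: is_derive_eq (is_derive_sum dX) _.
  rewrite -mulrA /phi -euler mulr_sumr -sumrN; apply: eq_bigr => k _.
  by rewrite /GRing.scale/= expr1; ring.
have qdec : forall s t, T0 <= s -> s <= t -> q t <= q s.
  by apply: is_derive_le0_nincr dq _ => t _; rewrite oppr_le0 !mulr_ge0// ltW.
pose L t := q t + (2 * c) * ((t - T0) * phi t).
have Ldec : forall s t, T0 <= s -> s <= t -> L t <= L s.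
  apply: (@is_derive_le0_nincr _ (fun t => - (2 * c * (t - T0) * G t))) => t Tt.
    have dt : is_derive t (1 : R) (fun t : R => t - T0) 1.
      by apply: is_derive_eq (is_deriveB (is_derive_id t 1) (is_derive_cst T0 t 1)) _;
         rewrite subr0.
    apply: is_derive_eq
      (is_deriveD (dq t Tt) (is_deriveZ (2 * c) (is_deriveM dt (dphi t Tt)))) _.
    by rewrite /GRing.scale/=; ring.
  by rewrite oppr_le0 !mulr_ge0 ?subr_ge0// ltW.
have phi0 : phi t @[t --> +oo] --> (0 : R).
  apply/cvgrPdist_le => e e0; near=> t.
  have Tt : T0 < t by near: t; apply: nbhs_pinfty_gt; exact: num_real.
  rewrite sub0r normrN ger0_norm; last exact: f0.
  have := Ldec T0 t (lexx _) (ltW Tt).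
  rewrite /L subrr mul0r mulr0 addr0 => Lt.
  (* Monotonicity of [L] gives 2 c (t - T0) phi(t) <= q(T0), so phi(t) <= e from this time on. *)
  have tT : q T0 / (2 * c * e) + T0 <= t.
    by near: t; apply: nbhs_pinfty_ge; exact: num_real.
  have {tT} : q T0 <= (t - T0) * (2 * c * e).
    by rewrite -ler_pdivrMr ?mulr_gt0// lerBrDr.
  have := q0 t; have tT : 0 < 2 * c * (t - T0) by rewrite !mulr_gt0// subr_gt0.
  by move=> ? ?; rewrite -(ler_pM2l tT); lra.
have [l Hl] := gradient_flow_cvg (rho := q T0) pf pg cg tg f0 dz
  (fun t Tt => qdec T0 t (lexx _) Tt) phi0.
exists l => //; apply: (cvg_unique (@Rhausdorff R) _ phi0).
exact: polyfun_cvg pf Hl.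
Unshelve. all: by end_near. Qed.

End GradientFlow.

(** * Simplex volumes and Gram determinants *)

Section Gram.
Context {R : realType}.

Lemma mulmx_tr_eq0 (d : nat) (v : 'rV[R]_d) : (v *m v^T == 0) = (v == 0).
Proof.
apply/idP/eqP => [/eqP/matrixP/(_ 0 0)|->]; last by rewrite mul0mx.
rewrite !mxE => /eqP; rewrite psumr_eq0 => [/allP v0|k _]; last first.
  by rewrite mxE -expr2 sqr_ge0.
apply/rowP => k; have /implyP/(_ isT) := v0 k (mem_index_enum _).
by rewrite !mxE -expr2 sqrf_eq0 => /eqP.
Qed.

Lemma mulmx_tr_ge0 (d : nat) (v : 'rV[R]_d) : 0 <= (v *m v^T) 0 0.
Proof. by rewrite mxE sumr_ge0// => k _; rewrite mxE -expr2 sqr_ge0. Qed.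

(* A negative determinant would give [char_poly (- A A^T)] a positive root, that
   is, give [A A^T] a negative eigenvalue. *)
Lemma det_gram_ge0 (n d : nat) (A : 'M[R]_(n, d)) : 0 <= \det (A *m A^T).
Proof.
set M := - (A *m A^T); pose p := char_poly M.
have p0 : p.[0] = \det (A *m A^T).
  have -> : p.[0] = (-1) ^+ n * \det M by rewrite horner_coef0 char_poly_det.
  rewrite (_ : M = -1 *: (A *m A^T)); last by rewrite scaleN1r.
  rewrite detZ mulrA -exprD addnn.
  by rewrite -signr_odd odd_double mul1r.
rewrite -p0 leNgt; apply/negP => pneg.
have [x Hx] : exists x, forall y, x <= y -> lead_coef p <= p.[y].
  have lc : 0 < lead_coef p by rewrite (monicP (char_poly_monic M)).
  by have [x] := poly_pinfty_gt_lc lc; exists x.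
pose b := Num.max x 0.
have b0 : 0 <= b by rewrite le_max lexx orbT.
have [|t /andP[t0 _] pt] := @poly_ivt _ p 0 b b0.
  rewrite (ltW pneg)/=; apply: le_trans (Hx b _); last by rewrite le_max lexx.
  by rewrite (monicP (char_poly_monic M)).
have {t0} : 0 < t.
  rewrite lt_neqAle t0 andbT; apply/eqP => E; move: pt; rewrite -E.
  by rewrite rootE (lt_eqF pneg).
move: pt; rewrite -eigenvalue_root_char => /eigenvalueP[v Ev v0] t0.
(* From v M = t v one gets |v A|^2 = -t |v|^2, negative for t > 0 and v != 0. *)
have := mulmx_tr_ge0 (v *m A).
have -> : (v *m A) *m (v *m A)^T = - t *: (v *m v^T).
  rewrite trmx_mul mulmxA -(mulmxA v) scaleNr scalemxAl -Ev /M.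
  by rewrite mulmxN mulNmx opprK.
have vv : 0 < (v *m v^T) 0 0.
  rewrite lt_def; apply/andP; split.
    apply: contra_neq v0 => vv; apply/eqP; rewrite -mulmx_tr_eq0.
    by apply/eqP/matrixP => i j; rewrite !ord1 vv mxE.
  exact: mulmx_tr_ge0.
by rewrite mxE mulNr oppr_ge0 leNgt mulr_gt0.
Qed.

End Gram.

Section Volume.
Context {R : realType} {d : nat}.

Definition edges (n : nat) (y : 'I_n.+1 -> 'rV[R]_d) : 'M[R]_(n, d) :=
  \matrix_(i, k) (y (lift ord0 i) 0 k - y ord0 0 k).

(** With p_i = y_i - y_0, the squared distances are |p_i|^2 + |p_j|^2 - 2 p_i . p_j. The unipotent
    congruence by [L] removes the squares using the border of ones, leaving the block -2 P P^T. *)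
Lemma det_cayley_menger (n : nat) (y : 'I_n.+1 -> 'rV[R]_d) :
  \det (cayley_menger y) =
  (-1) ^+ n.+1 * 2 ^+ n * \det (edges y *m (edges y)^T).
Proof.
set E := edges y; set G := E *m E^T.
pose P : 'M[R]_(1 + n, d) := col_mx 0 E.
have PE i k : P i k = y i 0 k - y ord0 0 k.
  rewrite /P mxE; case: splitP => j Ej.
    by rewrite mxE (_ : i = ord0) ?subrr//; apply: val_inj; rewrite /= Ej ord1.
  by rewrite mxE; congr (y _ 0 k - _); apply: val_inj; rewrite /= Ej.
pose W : 'M[R]_(1 + n) := block_mx 0 0 0 (- 2 *: G).
have WE : W = - 2 *: (P *m P^T).
  rewrite /W /P tr_col_mx mul_col_row !trmx0 !mulmx0 !mul0mx.
  by rewrite scale_block_mx !scaler0.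
clearbody P.
pose q : 'cV[R]_(1 + n) := \col_i \sum_k P i k ^+ 2.
pose L : 'M[R]_(1 + (1 + n)) := block_mx 1%:M 0 q 1%:M.
pose M : 'M[R]_(1 + (1 + n)) := block_mx 0 (const_mx 1) (const_mx 1) W.
have -> : cayley_menger y = L *m M *m L^T.
  rewrite /L /M tr_block_mx !mulmx_block !trmx0 !trmx1.
  rewrite !(mul0mx, mulmx0, mul1mx, mulmx1, add0r, addr0).
  congr block_mx; rewrite WE; apply/matrixP => i j.
  rewrite !mxE !big_ord1 !mxE mulr1 mul1r /sqdist mulr_sumr -!big_split/=.
  by apply: eq_bigr => k _; rewrite !mxE !PE; ring.
rewrite !det_mulmx det_tr det_lblock !det1 !mul1r mulr1.
(* Row [i0] belongs to vertex 0, where p_0 = 0: its only nonzero entry is the border 1 in column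
   [j0], and the minor is block triangular with blocks 1 and -2 G. *)
pose i0 : 'I_(1 + (1 + n)) := rshift 1 (lshift n ord0).
pose j0 : 'I_(1 + (1 + n)) := lshift (1 + n) ord0.
rewrite (expand_det_row M i0) (bigD1 j0)//= big1 ?addr0; last first.
  move=> j jj0; rewrite /M /i0; case: (split_ordP j) jj0 => a ->.
    by rewrite /j0 ord1 eqxx.
  rewrite block_mxEdr /W; case: (split_ordP a) => c -> _.
    by rewrite block_mxEul mxE mul0r.
  by rewrite block_mxEur mxE mul0r.
have -> : M i0 j0 = 1 by rewrite /M block_mxEdl mxE.
have cofE : row' i0 (col' j0 M) =
    block_mx 1%:M (const_mx 1) 0 (- 2 *: G) :> 'M[R]_(1 + n).
  apply/matrixP => i j; rewrite [LHS]mxE [LHS]mxE.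
  have -> : lift j0 j = rshift 1 j by exact: val_inj.
  case: (split_ordP i) => a ->.
    have -> : lift i0 (lshift n a) = lshift (1 + n) ord0.
      by apply: val_inj; rewrite /= ord1.
    rewrite /M block_mxEur mxE; case: (split_ordP j) => c ->.
      by rewrite block_mxEul !ord1 mxE.
    by rewrite block_mxEur mxE.
  have -> : lift i0 (rshift 1 a) = rshift 1 (rshift 1 a) by exact: val_inj.
  rewrite /M block_mxEdr /W; case: (split_ordP j) => c ->.
    by rewrite !block_mxEdl !mxE.
  by rewrite !block_mxEdr.
have sgn : (-1) ^+ (i0 + j0) = -1 :> R by [].
rewrite /cofactor cofE sgn det_ublock det1 detZ !mul1r.
rewrite -[- 2]mulN1r exprMn exprS; ring.
Qed.

(** The signs and powers of 2 cancel; the square undoes the root because a Gram determinant is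
    nonnegative. *)
Lemma sqr_Vol (n : nat) (y : 'I_n.+1 -> 'rV[R]_d) :
  Vol y ^+ 2 = \det (edges y *m (edges y)^T) / n`!%:R ^+ 2.
Proof.
have nf : n`!%:R != 0 :> R by rewrite pnatr_eq0 -lt0n fact_gt0.
have E : (-1) ^+ n.+1 / (2 ^+ n * n`!%:R ^+ 2) * \det (cayley_menger y) =
    \det (edges y *m (edges y)^T) / n`!%:R ^+ 2.
  rewrite det_cayley_menger; set D := \det _.
  have s1 : (-1) ^+ n.+1 * (-1) ^+ n.+1 = 1 :> R.
    by rewrite -exprD addnn -signr_odd odd_double.
  have -> : (-1) ^+ n.+1 / (2 ^+ n * n`!%:R ^+ 2) * ((-1) ^+ n.+1 * 2 ^+ n * D) =
    ((-1) ^+ n.+1 * (-1) ^+ n.+1) * (D / n`!%:R ^+ 2).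
    by field; rewrite nf expf_neq0.
  by rewrite s1 mul1r.
by rewrite /Vol E sqr_sqrtr// divr_ge0 ?det_gram_ge0// exprn_ge0.
Qed.

(** Adds to [V] the first m - dim V vectors of a basis of a complement. *)
Lemma vspace_extend (V : {vspace 'rV[R]_d}) (m : nat) : (\dim V <= m <= d)%N ->
  exists2 W : {vspace 'rV[R]_d}, (V <= W)%VS & \dim W = m.
Proof.
move=> /andP[Vm md]; pose X := take (m - \dim V) (vbasis V^C).
have dC : \dim V^C = (d - \dim V)%N.
  by rewrite dimv_compl dimvf /dim/= mul1n.
have sX : size X = (m - \dim V)%N.
  by rewrite size_takel// size_tuple dC leq_sub2r.
have fX : free X.
  have := basis_free (vbasisP V^C); rewrite -[X in free X](cat_take_drop (m - \dim V)).
  exact: catl_free.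
exists (V + <<X>>)%VS; first exact: addvSl.
rewrite dimv_disjoint_sum; first by rewrite (eqnP fX) sX subnKC.
apply/eqP; rewrite -subv0 -(capv_compl V) capvS//.
apply/span_subvP => v /mem_take; exact: vbasis_mem.
Qed.

(** A kernel vector u of the Gram matrix satisfies |u E|^2 = 0, so the edges are dependent and span
    at most n - 1 dimensions; since n - 1 <= d, their span extends to dimension exactly n - 1. *)
Lemma Vol_eq0_affine (n : nat) (y : 'I_n.+1 -> 'rV[R]_d) :
  (0 < n <= d.+1)%N -> Vol y ^+ 2 = 0 ->
  exists P : set 'rV[R]_d, affine_subspace n.-1 P /\ forall k, P (y k).
Proof.
move=> /andP[n0 nd] /eqP; rewrite sqr_Vol mulf_eq0 invr_eq0 expf_eq0/=.
rewrite pnatr_eq0 -[_ == 0%N]negbK -lt0n fact_gt0 orbF => /det0P[u u0 uG].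
have uE : u *m edges y = 0.
  apply/eqP; rewrite -mulmx_tr_eq0 trmx_mul mulmxA -(mulmxA u) uG.
  by rewrite mul0mx.
pose X := [tuple (y (lift ord0 i) - y ord0 : 'rV[R]_d) | i < n].
have dX : (\dim <<X>> < n)%N.
  rewrite ltnNge; apply/negP => nX.
  have fX : free X by rewrite /free eqn_leq dim_span size_tuple.
  case/negP: u0; apply/eqP/rowP => i; rewrite mxE.
  move/freeP: fX => /(_ (fun i => u 0 i)); apply.
  rewrite -[RHS]uE; apply/rowP => k; rewrite summxE mxE.
  apply: eq_bigr => j _; rewrite -tnth_nth tnth_mktuple !mxE.
  by [].
have [W XW dW] : exists2 W : {vspace 'rV[R]_d}, (<<X>> <= W)%VS & \dim W = n.-1.
  by apply: vspace_extend; rewrite -ltnS prednK// dX -ltnS prednK.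
exists [set y ord0 + w | w in [set w | w \in W]]; split.
  by exists (y ord0), W.
move=> k; exists (y k - y ord0) => /=; last by rewrite addrC subrK.
have [j ->|->] := unliftP ord0 k; last by rewrite subrr mem0v.
apply: (subvP XW); apply: memv_span.
by apply/tnthP; exists j; rewrite tnth_mktuple.
Qed.

End Volume.

(** * The reduced potential *)

Section Potential.
Context {R : realType} {d N n : nat}.
Context (kappa : R) (S : {set n.+1.-tuple 'I_N}).
Local Notation coord := 'I_#|{: 'I_N * 'I_d}|.
Implicit Type z : coord -> R.

(** All coordinates of all points are flattened into one vector indexed by pairs, to which the
    results on polynomial flows apply. *)
Definition config z (l : 'I_N) : 'rV[R]_d := \row_k z (enum_rank (l, k)).

Definition potential z : R := reduced_potential kappa S (config z).

Definition simplex_edges z (j : n.+1.-tuple 'I_N) : 'M[R]_(n, d) :=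
  edges (fun k => config z (tnth j k)).

Lemma potentialE z : potential z = kappa / (2 * n.+1%:R * #|S|%:R) *
  \sum_(j in S) \det (simplex_edges z j *m (simplex_edges z j)^T) / n`!%:R ^+ 2.
Proof. by congr (_ * _); apply: eq_bigr => j _; rewrite sqr_Vol. Qed.

Lemma polyfun_potential : polyfun potential.
Proof.
apply: (@eq_polyfun _ _ (fun z => kappa / (2 * n.+1%:R * #|S|%:R) *
  \sum_(j in S) \det (simplex_edges z j *m (simplex_edges z j)^T) / n`!%:R ^+ 2)).
  by move=> z; rewrite potentialE.
have pe j a k : polyfun (fun z => simplex_edges z j a k).
  apply: (@eq_polyfun _ _ (fun z => z (enum_rank (tnth j (lift ord0 a), k)) -
    z (enum_rank (tnth j ord0, k)))); first by move=> z; rewrite !mxE.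
  by apply: polyfun_sub; exact: polyfun_var.
apply: polyfun_mul; first exact: polyfun_cst.
apply: polyfun_sum => j _; apply: polyfun_mul; last exact: polyfun_cst.
apply: polyfun_det => a b.
apply: (@eq_polyfun _ _ (fun z => \sum_k simplex_edges z j a k * simplex_edges z j b k)).
  by move=> z; rewrite [RHS]mxE; apply: eq_bigr => k _; rewrite [_^T _ _]mxE.
by apply: polyfun_sum => k _; exact: polyfun_mul.
Qed.

Lemma potential_ge0 z : 0 < kappa -> 0 <= potential z.
Proof.
move=> kappa0; apply: mulr_ge0.
  by apply: divr_ge0; [exact: ltW|rewrite !mulr_ge0].
by rewrite sumr_ge0// => j _; exact: sqr_ge0.
Qed.

Lemma potential_homogeneous (s : R) z :
  potential (fun p => s * z p) = s ^+ (2 * n) * potential z.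
Proof.
rewrite !potentialE [RHS]mulrCA [in RHS]mulr_sumr; congr (_ * _).
apply: eq_bigr => j _; rewrite mulrA; congr (_ / _).
have -> : simplex_edges (fun p => s * z p) j = s *: simplex_edges z j.
  by apply/matrixP => a k; rewrite !mxE mulrBr.
by rewrite linearZ/= -scalemxAl -scalemxAr scalerA detZ -expr2 exprM.
Qed.

(** Both sides are the derivative at s = 1 of the potential at s z, by the chain rule and by
    homogeneity of degree 2n. *)
Lemma potential_euler (g : coord -> (coord -> R) -> R) z : chain_rule potential g ->
  \sum_p g p z * z p = (2 * n)%:R * potential z.
Proof.
move=> cg.
have dz p : is_derive (1 : R) (1 : R) (fun s : R => s * z p) (z p).
  have := is_deriveM (is_derive_id (1 : R) 1) (is_derive_cst (z p) (1 : R) (1 : R)).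
  by move=> /is_derive_eq; apply; rewrite scaler0 add0r /GRing.scale/= mulr1.
have := cg (fun p s => s * z p) z 1 dz => -[_ D1].
have := is_deriveM (is_deriveX (2 * n) (is_derive_id (1 : R) 1))
  (is_derive_cst (potential z) (1 : R) (1 : R)) => -[_ D2].
have E : (fun s : R => potential (fun p => s * z p)) =
    (id ^+ (2 * n) * cst (potential z) : R -> R).
  by apply/funext => s; rewrite potential_homogeneous !fctE.
have E1 : (fun p => 1 * z p) = z by apply/funext => p; rewrite mul1r.
move: D1; rewrite E1 E D2 => <-.
by rewrite scaler0 add0r /GRing.scale/= expr1n !mulr1 mulrC.
Qed.

(** Moving point [i] along the k-th basis vector changes the single flat coordinate [p]; the chain
    rule along that line identifies the directional derivative with g_p. *)
Lemma grad_at_potential (g : coord -> (coord -> R) -> R) (i : 'I_N) (k : 'I_d) z :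
  chain_rule potential g ->
  grad_at (reduced_potential kappa S) i (config z) 0 k = g (enum_rank (i, k)) z.
Proof.
move=> cg; rewrite mxE; set p := enum_rank _.
have dl q : is_derive (0 : R) (1 : R) (fun h : R => z q + h * (q == p)%:R) (q == p)%:R.
  have := is_deriveD (is_derive_cst (z q) (0 : R) (1 : R))
    (is_deriveM (is_derive_id (0 : R) 1) (is_derive_cst ((q == p)%:R : R) (0 : R) (1 : R))).
  by move=> /is_derive_eq; apply; rewrite scaler0 !add0r /GRing.scale/= mulr1.
have := cg (fun q h => z q + h * (q == p)%:R) _ 0 dl => -[_].
rewrite (bigD1 p)//= eqxx mulr1 big1 ?addr0; last first.
  by move=> q /negbTE->; rewrite mulr0.
have -> : (fun q => z q + 0 * (q == p)%:R) = z.
  by apply/funext => q; rewrite mul0r addr0.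
move=> <-; rewrite /derive; congr (lim (_ @ 0^')).
apply/funext => h.
have conf (h' : R) : ([eta config z with i |-> h' *: delta_mx 0 k + config z i]
      : 'I_N -> 'rV[R]_d) =
    config (fun q => z q + h' * (q == p)%:R).
  apply/funext => l; apply/rowP => k' /=; rewrite [RHS]mxE.
  rewrite (inj_eq enum_rank_inj) xpair_eqE.
  by case: eqP => [->|_]; rewrite !mxE ?eqxx/= ?mulr0 ?addr0// addrC.
congr (_ *: (_ - _)).
  by rewrite /= conf addr0 /potential; congr (reduced_potential _ _ (config _));
     apply/funext => q; rewrite /GRing.scale/= mulr1.
by rewrite /potential -conf scale0r add0r.
Qed.

End Potential.

(** * Convergence and degenerate limits for the reduced flow *)

Theorem theorem4p1 (R : realType) (d N n : nat)
    (hd : (1 <= d)%N) (hN : (1 <= N)%N) (hn : (1 <= n <= d.+1)%N)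
    (kappa : R) (hkappa : 0 < kappa)
    (S : {set n.+1.-tuple 'I_N})
    (hSperm : perm_invariant S)
    (hSslice : forall i : 'I_N, slice S i != finset.set0)
    (x0 : 'I_N -> 'rV[R]_d) (x : 'I_N -> R -> 'rV[R]_d)
    (hx : reduced_gradient_flow kappa S x0 x) :
  exists xinf : 'I_N -> 'rV[R]_d,
    (forall i : 'I_N, x i t @[t --> +oo] --> xinf i) /\
    (forall j : n.+1.-tuple 'I_N, j \in S ->
       exists P : set 'rV[R]_d,
         affine_subspace n.-1 P /\
         forall k : 'I_n.+1, P (xinf (tnth j k))).
Proof.
have pV := polyfun_potential kappa S (d := d).
have [g [pg cg tg]] := polyfun_gradient pV.
pose z (p : 'I_#|{: 'I_N * 'I_d}|) (t : R) : R := x (enum_val p).1 t 0 (enum_val p).2.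
have zx t l : config (z^~ t) l = x l t.
  by apply/rowP => k; rewrite mxE /z enum_rankK.
(* The flow equation holds only for t > 0, so the closed half-line of times is started at 1. *)
have dz (t : R) : 1 <= t -> forall p, is_derive t (1 : R) (z p) (- g p (z^~ t)).
  move=> t1 p; have t0 : 0 < t by exact: lt_le_trans t1.
  have [_ _ /(_ t t0)[dx Dx]] := hx (enum_val p).1.
  split; first by move/derivable_mxP: dx; exact.
  have := derive_mx dx; rewrite Dx => /matrixP/(_ 0 (enum_val p).2).
  rewrite [RHS]mxE => <-; rewrite [LHS]mxE; congr (- _).
  rewrite (_ : (fun l => x l t) = config (z^~ t)); last by apply/funext => l.
  by rewrite (grad_at_potential _ _ _ cg) -surjective_pairing enum_valK.
have [n0 nd] := andP hn.
have c0 : 0 < (2 * n)%:R :> R by rewrite ltr0n muln_gt0.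
have [l zl Vl] := homogeneous_gradient_flow_cvg pV pg cg tg
  (fun z => potential_ge0 S z hkappa) c0 (fun z => potential_euler z cg) dz.
exists (config l); split=> [i|j jS].
  apply/cvgrPdist_le => /= e e0.
  have : \forall t \near +oo, forall k, `|config l i 0 k - x i t 0 k| <= e.
    apply: filter_forall => k; move: (zl (enum_rank (i, k))) => /cvgrPdist_le/(_ e e0).
    by apply: filterS => t; rewrite /z enum_rankK mxE.
  apply: filterS => t xt; rewrite [leLHS]/Num.norm/= mx_normrE.
  apply/bigmax_leP; split=> [|[a k] _ /=]; first exact: ltW.
  by have := xt k; rewrite (ord1 a) !mxE.
apply: Vol_eq0_affine => //.
(* The membership of [j] makes |S| positive, so the vanishing potential forces each squared volume
   in the sum to vanish. *)
have Spos : 0 < kappa / (2 * n.+1%:R * #|S|%:R).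
  by rewrite divr_gt0// !mulr_gt0// ltr0n card_gt0; apply/set0Pn; exists j.
move: Vl; rewrite /potential /reduced_potential => /eqP.
rewrite mulf_eq0 (gt_eqF Spos)/= psumr_eq0 => [/allP/(_ j (mem_index_enum _))|i _].
  by rewrite jS => /eqP.
exact: sqr_ge0.
Qed.
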